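(* Let $\gamma_1\in\mathbb{R}$, let $\xi_1,\xi_2,\dots$ be independent random variables each uniformly distributed over $[2,3]$, define $\gamma_{j+1}:=\gamma_j+1+\xi_j$ for $j\in\mathbb{N}$, and set $S:=\bigcup_{j=1}^\infty[\gamma_j,\gamma_j+1]$. Then with probability one, no uniformly discrete set $\Lambda\subset\mathbb{R}$ is a uniqueness set for $W^{(\alpha)}_S$ (for $\alpha>1/2$).
   Context: Fourier transform: $\hat f(t)=\int e^{-2\pi i t x}f(x)\,dx$. For $\alpha>1/2$, $W^{(\alpha)}_S$ is the space of functions $f$ whose Fourier transform $F=\hat f$ satisfies $\int_{\mathbb{R}}(1+|t|^{2\alpha})|F(t)|^2\,dt<\infty$ and $F=0$ a.e. outside $S$ (such $f$ are continuous). A set $\Lambda$ is uniformly discrete if $\inf\{|\lambda-\lambda'|:\lambda\neq\lambda'\in\Lambda\}>0$. $\Lambda$ is a uniqueness set for a space of continuous functions if the only function in it vanishing on $\Lambda$ is zero. *)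

(* Defs.v *)
From HB Require Import structures.
From mathcomp Require Import all_boot all_order all_algebra.
From mathcomp Require Import all_classical all_reals all_analysis.
From mathcomp Require Import complex.

Set Implicit Arguments.
Unset Strict Implicit.
Unset Printing Implicit Defensive.

Import Order.TTheory GRing.Theory Num.Theory.
Import numFieldNormedType.Exports.
Local Open Scope classical_set_scope.
Local Open Scope ring_scope.

Section Defs.
Variable R : realType.

Definition mutually_independent d (T : measurableType d) (P : probability T R)
    (X : nat -> {RV P >-> R}) : Prop :=
  forall (I : seq nat) (B : nat -> set R),
    uniq I -> (forall i, i \in I -> measurable (B i)) ->
    P (\bigcap_(i in [set` I]) (X i @^-1` B i)) =
    (\prod_(i <- I) P (X i @^-1` B i))%E.

Lemma two_lt_three : (2 : R) < 3.
Proof. by rewrite ltr_nat. Qed.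

Definition uniform23 d (T : measurableType d) (P : probability T R)
    (X : {RV P >-> R}) : Prop :=
  forall A : set R, measurable A ->
    distribution P X A = uniform_prob two_lt_three A.

(** gamma 0 = gamma_1, gamma (j+1) = gamma j + 1 + xi_j  (0-based indices:
    xi j here is xi_{j+1} of the paper). *)
Fixpoint gamma_seq (g1 : R) (xi : nat -> R) (j : nat) : R :=
  match j with
  | 0 => g1
  | j'.+1 => gamma_seq g1 xi j' + 1 + xi j'
  end.

Definition S_set (g1 : R) (xi : nat -> R) : set R :=
  \bigcup_(j in [set: nat]) `[gamma_seq g1 xi j, gamma_seq g1 xi j + 1]%classic.

Definition cintegral (g : R -> R[i]) : R[i] :=
  ((Rintegral lebesgue_measure setT (fun t => complex.Re (g t)))
   +i* (Rintegral lebesgue_measure setT (fun t => complex.Im (g t))))%C.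

Definition expi (theta : R) : R[i] := (cos theta +i* sin theta)%C.

Definition cnorm2 (z : R[i]) : R := complex.Re z ^+ 2 + complex.Im z ^+ 2.

Definition W_space (alpha : R) (S : set R) : set (R -> R[i]) :=
  [set f | exists F : R -> R[i],
     [/\ measurable_fun setT (fun t => complex.Re (F t)),
         measurable_fun setT (fun t => complex.Im (F t)),
         (\int[lebesgue_measure]_(t in setT)
             ((1 + `|t| `^ (2 * alpha)) * cnorm2 (F t))%:E < +oo)%E,
         {ae lebesgue_measure, forall t, ~ S t -> F t = 0}
       & forall x, f x = cintegral (fun t => expi (2 * pi * t * x) * F t)]].

Definition uniformly_discrete (L : set R) : Prop :=
  exists2 delta : R, 0 < delta &
    forall l l', L l -> L l' -> l != l' -> delta <= `|l - l'|.

Definition uniqueness_set (L : set R) (W : set (R -> R[i])) : Prop :=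
  forall f, W f -> (forall l, L l -> f l = 0) -> f = (fun _ => 0).

End Defs.

(* Main.v *)
(** We produce a nonzero f in the space vanishing on L by interpolating on
    L' = L + {l0} a sequence that is 1 at l0 and 0 on L.

    Almost surely every finite pattern of gaps in [2, 3] occurs approximately
    among the xi's.  Choosing a pattern made of stretches with slightly different
    constant gaps, we get finitely many left endpoints c_m of components of S
    such that the averages of e^(2 pi i z c_m) are small uniformly in
    dl <= |z| <= W.  Averaging translates by c_m of a C^1 bump on [0, 1] gives
    a weight supported in a bounded part of S whose transform g satisfies
    g(0) = 1, is tiny for dl <= |z| <= W, and decays like |z|^-3.  Hence for
    every dl-separated L' the matrix g(l - l') is, on l1(L'), within 1/2 of the
    identity.  The interpolation problem is then solved by successive
    corrections, each supported on a finite subset of L' and reducing the l1 norm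
    of the error by the factor 3/4; the resulting Fourier transforms are bounded
    by a convergent geometric series and all live on the same bounded part of S,
    so the sum belongs to the space. *)

Require Import Defs.
From HB Require Import structures.
From mathcomp Require Import all_boot all_order all_algebra.
From mathcomp Require Import all_classical all_reals all_analysis.
From mathcomp Require Import complex measurable_realfun.
From mathcomp Require Import ring lra.
Import Order.TTheory GRing.Theory Num.Theory.
Import numFieldNormedType.Exports.
Local Open Scope classical_set_scope.
Local Open Scope ring_scope.

Set Implicit Arguments.
Unset Strict Implicit.
Unset Printing Implicit Defensive.

(** * Random gap patterns *)

Section Blocks.
Variables (R : realType) (d : measure_display) (T : measurableType d).
Variables (P : probability T R) (xi : nat -> {RV P >-> R}).
Variables (L : nat) (C : nat -> set R).
Hypothesis xi_indep : mutually_independent xi.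
Hypothesis mC : forall m, measurable (C m).

Definition cylinder (I : seq nat) (B : nat -> set R) : set T :=
  \bigcap_(i in [set` I]) (xi i @^-1` B i).

(** The blocks occupy disjoint ranges of indices, and [i %% L] is the position of [i] inside its
    block, so every block asks for the same pattern. *)
Definition block_event (b : nat) : set T :=
  cylinder (iota (b * L) L) (fun i => C (i %% L)%N).

Lemma measurable_cylinder I B : (forall i, i \in I -> measurable (B i)) ->
  measurable (cylinder I B).
Proof.
move=> mB; apply: bigcap_measurableType.
by move=> i iI; apply: measurable_funPTI; exact: mB.
Qed.

Lemma measurable_block_event b : measurable (block_event b).
Proof. by apply: measurable_cylinder. Qed.

Variable r : R.
Hypothesis block_prob : forall b, P (block_event b) = r%:E.

(** Independence is given for finite cylinders, so the induction on [b] carries an arbitrary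
    cylinder over later indices. Missing one more block is a difference of two probabilities, and
    block [b] intersected with that cylinder is again a cylinder to which the induction hypothesis
    applies. *)
Lemma no_block_cylinder b I B : uniq I -> {in I, forall i, (b * L <= i)%N} ->
  (forall i, i \in I -> measurable (B i)) ->
  P (\big[setI/setT]_(k < b) ~` block_event k `&` cylinder I B) =
  (((1 - r) ^+ b)%:E * P (cylinder I B))%E.
Proof.
elim: b I B => [|b IH] I B uI bI mB.
  by rewrite big_ord0 setTI expr0 mul1e.
pose B' i := if (i < b.+1 * L)%N then C (i %% L)%N else B i.
have mB' i : i \in iota (b * L) L ++ I -> measurable (B' i).
  rewrite /B'; case: ifP => // bi; rewrite mem_cat => /orP[|/mB//].
  by rewrite mem_iota -mulSnr bi andbF.
have inI i : i \in I -> (i < b.+1 * L)%N = false.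
  by move=> /bI bi; rewrite ltnNge bi.
have inJ i : i \in iota (b * L) L -> (i < b.+1 * L)%N.
  by rewrite mem_iota -mulSnr => /andP[].
have uB' : uniq (iota (b * L) L ++ I).
  rewrite cat_uniq iota_uniq uI andbT /=; apply/hasPn => i iI.
  by apply/negP => /inJ; rewrite inI.
have cylE : block_event b `&` cylinder I B = cylinder (iota (b * L) L ++ I) B'.
  apply/seteqP; split=> [w [Ew Iw] i /=|w Bw].
    rewrite mem_cat /B' => /orP[iJ|iI].
    - by rewrite inJ//; exact: Ew.
    - by rewrite inI//; exact: Iw.
  split=> i /= iI; have := Bw i; rewrite /= mem_cat iI ?orbT => /(_ isT).
  - by rewrite /B' inJ.
  - by rewrite /B' inI.
have PcylE : P (cylinder (iota (b * L) L ++ I) B') = (r%:E * P (cylinder I B))%E.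
  rewrite /cylinder xi_indep// big_cat/=; congr (_ * _)%E.
    rewrite -(block_prob b) /block_event /cylinder xi_indep ?iota_uniq//.
    by apply: eq_big_seq => i iJ; rewrite /B' inJ.
  rewrite xi_indep//.
  by apply: eq_big_seq => i iI; rewrite /B' inI.
set A := \big[setI/setT]_(k < b) ~` block_event k.
have mA : measurable A.
  by apply: bigsetI_measurable => k _; apply: measurableC; exact: measurable_block_event.
have mI := measurable_cylinder mB.
have PD : P (A `&` cylinder I B `\` block_event b) =
    (P (A `&` cylinder I B) - P (A `&` cylinder I B `&` block_event b))%E.
  apply: measureD.
  - exact: measurableI.
  - exact: measurable_block_event.
  - by rewrite (le_lt_trans (probability_le1 _ _)) ?ltry//; exact: measurableI.
have bSb i : (b.+1 * L <= i)%N -> (b * L <= i)%N.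
  by apply: leq_trans; rewrite leq_mul2r leqnSn orbT.
rewrite big_ord_recr/= -/A -setIA [X in _ `&` X]setIC setIA -setDE PD.
rewrite -(setIA A) (setIC (cylinder I B)) cylE !IH//; last 2 first.
- move=> i; rewrite mem_cat => /orP[|/bI /bSb//].
  by rewrite mem_iota => /andP[].
- by move=> i /bI /bSb.
rewrite PcylE; have /fineK <- : P (cylinder I B) \is a fin_num.
  exact: fin_num_measure.
by rewrite -!EFinM -EFinB; congr EFin; rewrite exprSr; ring.
Qed.

(** Missing the first [b] blocks has probability [(1 - r) ^+ b], which tends to 0. *)
Lemma no_block_negligible : 0 < r ->
  P.-negligible (\bigcap_b ~` block_event b).
Proof.
move=> r0; set N := \bigcap_b _.
have mE b : measurable (~` block_event b).
  by apply: measurableC; exact: measurable_block_event.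
have mN : measurable N by exact: bigcapT_measurable.
have r1 : r <= 1.
  by rewrite -lee_fin -(block_prob 0) probability_le1//; exact: measurable_block_event.
exists N; split => //.
have Nle b : (P N <= ((1 - r) ^+ b)%:E)%E.
  have := @no_block_cylinder b [::] (fun=> setT) isT.
  have -> : cylinder [::] (fun=> setT) = setT :> set T.
    by apply/seteqP; split => // w _ i.
  rewrite probability_setT mule1 setIT => <- //.
  apply: le_measure; rewrite ?inE//; first exact: bigsetI_measurable.
  by move=> w Nw; rewrite -(bigcap_mkord b (fun k => ~` block_event k)) => k _; exact: Nw.
apply/eqP; rewrite eq_le measure_ge0 andbT.
have cvg0 : ((1 - r) ^+ b @[b --> \oo] --> (0 : R)).
  by apply: cvg_expr; rewrite ger0_norm ?subr_ge0// ltrBlDr ltrDl.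
have /fineK PN : P N \is a fin_num by exact: fin_num_measure.
rewrite -PN lee_fin; apply: (cvgr_to_ge cvg0); apply: nearW => b.
by rewrite -lee_fin PN.
Qed.

End Blocks.

Section UniformBlocks.
Variables (R : realType) (d : measure_display) (T : measurableType d).
Variables (P : probability T R) (xi : nat -> {RV P >-> R}).
Hypothesis xi_indep : mutually_independent xi.
Hypothesis xi_unif : forall j, uniform23 (xi j).

Lemma uniform_prob_itv (a t : R) : 2 <= a -> a + t <= 3 -> 0 <= t ->
  uniform_prob (@two_lt_three R) `[a, a + t] = t%:E.
Proof.
move=> a2 a3 t0; rewrite /uniform_prob.
rewrite (eq_integral (cst 1%E)); last first.
  move=> x; rewrite inE/= in_itv/= => /andP[ax xt].
  rewrite /uniform_pdf ifT; last by apply/andP; split; lra.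
  by congr EFin; rewrite (_ : 3 - 2 = 1) ?invr1//; ring.
rewrite integral_cst//= mul1e; apply: etrans (lebesgue_measure_itv _) _.
rewrite /= lte_fin.
case: ifPn => [_|]; first by rewrite -EFinB addrAC subrr add0r.
by rewrite -leNgt => h; congr EFin; lra.
Qed.

(** The density is 1 on [2, 3], so [t] is both the tolerance and the probability that a single gap
    fits; every block then has the same positive probability [t ^+ L]. *)
Lemma near_pattern_ae (L : nat) (q : nat -> R) (t : R) : 0 < t ->
  (forall m, 2 <= q m /\ q m + t <= 3) ->
  {ae P, forall w, exists a, forall m, (m < L)%N ->
     q m <= xi (a + m)%N w <= q m + t}.
Proof.
move=> t0 hq; pose C m := `[q m, q m + t]%classic.
have mC m : measurable (C m) by exact: measurable_itv.
have PE i m : P (xi i @^-1` C m) = t%:E.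
  rewrite -[LHS]/(distribution P (xi i) (C m)) xi_unif//.
  by have [? ?] := hq m; rewrite uniform_prob_itv// ltW.
have block_prob b : P (block_event xi L C b) = (t ^+ L)%:E.
  rewrite /block_event /cylinder xi_indep ?iota_uniq//.
  rewrite (eq_bigr (fun=> t%:E)) => [|i _]; last exact: PE.
  elim: L (b * L)%N => [n|l IH n]; first by rewrite big_nil expr0.
  by rewrite big_cons IH exprS EFinM.
apply: negligibleS (no_block_negligible xi_indep mC block_prob _); last first.
  exact: exprn_gt0.
move=> w /= nw b _ Eb; apply: nw; exists (b * L)%N => m mL.
have := Eb (b * L + m)%N; rewrite /= mem_iota leq_addr ltn_add2l => /(_ mL).
by rewrite modnMDl modn_small//= in_itv.
Qed.

End UniformBlocks.

(** * The bump *)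

Section Bump.
Variable R : realType.
Implicit Types (c w s t : R).

Lemma is_derive_mul (f g : R -> R) (t a b : R) :
  is_derive t 1 f a -> is_derive t 1 g b ->
  is_derive t 1 (fun x => f x * g x) (f t * b + g t * a).
Proof.
move=> df dg; exact: is_deriveM.
Qed.

Lemma Rintegral_derive (f F : R -> R) (a b : R) : a < b ->
  (forall t, is_derive t 1 F (f t)) -> continuous f ->
  \int[lebesgue_measure]_(t in `[a, b]) f t = F b - F a.
Proof.
move=> ab dF cf.
have cF : continuous F.
  move=> t; apply: differentiable_continuous; apply/derivable1_diffP.
  exact: (@ex_derive _ _ _ _ _ _ _ (dF t)).
rewrite /Rintegral (@continuous_FTC2 _ f F)//.
- by apply: continuous_subspaceT.
- split.
  + by move=> t _; exact: (@ex_derive _ _ _ _ _ _ _ (dF t)).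
  + by apply: cvg_at_right_filter; exact: cF.
  + by apply: cvg_at_left_filter; exact: cF.
- by move=> t _; rewrite derive1E; exact: (@derive_val _ _ _ _ _ _ _ (dF t)).
Qed.

(* The double zeros at 0 and 1 make the transform decay like the inverse cube, one
   power more than is needed for summability over separated sets. *)
Definition bump_poly (u : R) : R := 30 * (u ^+ 2 * (1 - u) ^+ 2).

Lemma is_derive_sub c t : is_derive t 1 (fun x => x - c) 1.
Proof. by apply: is_derive_eq; rewrite subr0. Qed.

Lemma is_derive_cos_affine w s t :
  is_derive t 1 (fun x => cos (w * x + s)) (- (w * sin (w * t + s))).
Proof.
have dl : is_derive t 1 (fun x => w * x + s) w.
  by apply: is_derive_eq; rewrite /GRing.scale/= addr0 mulr1.
have := @is_derive1_comp _ (@cos R) (fun x => w * x + s) t _ _ (is_derive_cos _) dl.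
by rewrite mulNr mulrC.
Qed.

Lemma is_derive_sin_affine w s t :
  is_derive t 1 (fun x => sin (w * x + s)) (w * cos (w * t + s)).
Proof.
have dl : is_derive t 1 (fun x => w * x + s) w.
  by apply: is_derive_eq; rewrite /GRing.scale/= addr0 mulr1.
have := @is_derive1_comp _ (@sin R) (fun x => w * x + s) t _ _ (is_derive_sin _) dl.
by rewrite mulrC.
Qed.

Lemma continuous_cos_affine w s : continuous (fun x : R => cos (w * x + s)).
Proof.
move=> t; apply: differentiable_continuous; apply/derivable1_diffP.
exact: (@ex_derive _ _ _ _ _ _ _ (is_derive_cos_affine w s t)).
Qed.

Lemma is_derive_bump_poly c t : is_derive t 1 (fun x => bump_poly (x - c))
  (30 * (2 * (t - c) - 6 * (t - c) ^+ 2 + 4 * (t - c) ^+ 3)).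
Proof.
have du := is_derive_sub c t.
have d1 : is_derive t 1 (fun x => 1 - (x - c)) (-1).
  by apply: is_derive_eq; ring.
have d2 := is_derive_mul du du.
have d3 := is_derive_mul d1 d1.
have d5 := is_derive_mul (is_derive_cst (30 : R) t 1) (is_derive_mul d2 d3).
apply: is_derive_eq d5 _ => /=.
by ring.
Qed.

Lemma continuous_bump_poly c : continuous (fun x : R => bump_poly (x - c)).
Proof.
move=> t; apply: differentiable_continuous; apply/derivable1_diffP.
exact: (@ex_derive _ _ _ _ _ _ _ (is_derive_bump_poly c t)).
Qed.

(** The bump and its derivative vanish at both endpoints, so integration by parts leaves no boundary
    term before order [w ^- 3]. *)
Lemma Rintegral_bump_cos c w s : w != 0 ->
  \int[lebesgue_measure]_(t in `[c, c + 1]) (bump_poly (t - c) * cos (w * t + s)) =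
  30 * (- 2 * (sin (w * c + (w + s)) - sin (w * c + s)) / w ^+ 3
        - 12 * (cos (w * c + (w + s)) + cos (w * c + s)) / w ^+ 4
        + 24 * (sin (w * c + (w + s)) - sin (w * c + s)) / w ^+ 5).
Proof.
move=> w0.
(* With p the bump polynomial, [A1] is p / w - p'' / w^3 + p'''' / w^5 and [A2] is p' / w^2 - p''' /
   w^4: the coefficients of sine and cosine obtained by integrating by parts until the derivatives
   of p vanish. *)
pose A1 u : R := 30 * (u ^+ 2 - 2 * u ^+ 3 + u ^+ 4) / w - 30 * (2 - 12 * u + 12 * u ^+ 2) / w ^+ 3 + 30 * 24 / w ^+ 5.
pose A2 u : R := 30 * (2 * u - 6 * u ^+ 2 + 4 * u ^+ 3) / w ^+ 2 - 30 * (24 * u - 12) / w ^+ 4.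
pose F t := A1 (t - c) * sin (w * t + s) + A2 (t - c) * cos (w * t + s).
have dA1 t : is_derive t 1 (fun x => A1 (x - c))
  (30 * (2 * (t - c) - 6 * (t - c) ^+ 2 + 4 * (t - c) ^+ 3) / w - 30 * (24 * (t - c) - 12) / w ^+ 3).
  by rewrite /A1; apply: is_derive_eq; rewrite /GRing.scale/=; field.
have dA2 t : is_derive t 1 (fun x => A2 (x - c))
  (30 * (2 - 12 * (t - c) + 12 * (t - c) ^+ 2) / w ^+ 2 - 30 * 24 / w ^+ 4).
  by rewrite /A2; apply: is_derive_eq; rewrite /GRing.scale/=; field.
have dF t : is_derive t 1 F (bump_poly (t - c) * cos (w * t + s)).
  have dS := is_derive_mul (dA1 t) (is_derive_sin_affine w s t).
  have dC := is_derive_mul (dA2 t) (is_derive_cos_affine w s t).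
  apply: is_derive_eq (is_deriveD dS dC) _.
  by rewrite /A1 /A2 /bump_poly; field.
rewrite (Rintegral_derive _ dF); last 2 first.
- by rewrite ltrDl.
- by move=> t; apply: cvgM; [exact: continuous_bump_poly|exact: continuous_cos_affine].
rewrite /F /A1 /A2 subrr (_ : c + 1 - c = 1); last by ring.
rewrite (_ : w * (c + 1) + s = w * c + (w + s)); last by ring.
by field.
Qed.

(** The factor 30 in [bump_poly] is chosen for this normalisation, as u^2 (1 - u)^2 has integral
    1/30 over [0, 1]. *)
Lemma Rintegral_bump c :
  \int[lebesgue_measure]_(t in `[c, c + 1]) bump_poly (t - c) = 1.
Proof.
pose A u : R := 10 * u ^+ 3 - 15 * u ^+ 4 + 6 * u ^+ 5.
have dA t : is_derive t 1 (fun x => A (x - c)) (bump_poly (t - c)).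
  by rewrite /A; apply: is_derive_eq; rewrite /GRing.scale/= /bump_poly; ring.
rewrite (Rintegral_derive _ dA); last 2 first.
- by rewrite ltrDl.
- exact: continuous_bump_poly.
by rewrite /A; ring.
Qed.

End Bump.

(** * Exponential sums over runs of nearly constant gaps *)

Section ExponentialSums.
Variable R : realType.
Implicit Types (w s t z : R).

Lemma cos_lipschitz (a b : R) : `|cos a - cos b| <= `|a - b|.
Proof.
wlog ab : a b / a <= b => [h|].
  by case: (leP a b) => [/h//|/ltW/h]; rewrite distrC [leRHS]distrC.
have [] := @MVT_segment R cos (fun x => - sin x) a b ab.
  by apply: continuous_subspaceT; exact: continuous_cos.
move=> c _ h; rewrite distrC h [leRHS]distrC normrM normrN.
by rewrite ler_piMl// sin_max.
Qed.

(** The sum telescopes, because [2 * sin (t / 2) * cos u] equals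
    [sin (u + t / 2) - sin (u - t / 2)]. The free phase [s] covers sine sums as well. *)
Lemma dirichlet_sum (N : nat) t s :
  2 * sin (t / 2) * \sum_(0 <= k < N) cos (t * k%:R + s) =
  sin (t * N%:R + s - t / 2) - sin (s - t / 2).
Proof.
elim: N => [|N IH]; first by rewrite big_nil mulr0 mulr0 add0r subrr.
rewrite big_nat_recr//= mulrDr IH.
have -> : t * N.+1%:R + s - t / 2 = (t * N%:R + s) + t / 2.
  by rewrite -natr1 mulrDr mulr1 -!addrA; congr (_ + _); lra.
by rewrite (sinD _ (t / 2)) (sinB (t * _ + s)); ring.
Qed.

Lemma dirichlet_bound (N : nat) t s :
  `|sin (t / 2)| * `|\sum_(0 <= k < N) cos (t * k%:R + s)| <= 1.
Proof.
rewrite -normrM -(@ler_pM2l _ 2)// mulr1 -[X in X * _]ger0_norm//.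
rewrite -normrM mulrA dirichlet_sum; apply: le_trans (ler_normB _ _) _.
by rewrite -[leRHS]/(1 + 1) lerD// sin_max.
Qed.

Lemma sum_cos_le (I : Type) (r : seq I) (f : I -> R) :
  `|\sum_(i <- r) cos (f i)| <= (size r)%:R.
Proof.
apply: le_trans (ler_norm_sum _ _ _) _.
rewrite -sum1_size natr_sum ler_sum// => i _; exact: cos_max.
Qed.

Lemma sin_diff_le (a b : R) : `|sin (a - b)| <= `|sin a| + `|sin b|.
Proof.
rewrite sinB; apply: le_trans (ler_normB _ _) _.
by rewrite !normrM lerD// ?ler_piMr ?ler_piMl// cos_max.
Qed.

Lemma sin_norm_ge (a b : R) : 0 <= a -> a <= `|b| -> `|b| <= pi / 2 -> sin a <= `|sin b|.
Proof.
move=> a0 ab bpi.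
have -> : `|sin b| = `|sin `|b| |.
  by case: (ger0P b) => _//; rewrite sinN normrN.
apply: le_trans (ler_norm _).
have pi0 := pi_ge0 R.
by rewrite leNgt ltr_sin ?in_itv/= -?leNgt//; lra.
Qed.

(** An index with [eta <= b i] contributes at most [1 / eta]; at most one index escapes this, and it
    costs the trivial bound [N]. *)
Lemma sum_at_most_one_bad (K : nat) (D b : nat -> R) (N eta : R) :
  0 < eta -> 0 <= N ->
  (forall i, 0 <= D i) -> (forall i, D i <= N) -> (forall i, b i * D i <= 1) ->
  (forall i j, (i < K)%N -> (j < K)%N -> i != j -> b i < eta -> b j < eta -> False) ->
  \sum_(0 <= i < K) D i <= N + K%:R / eta.
Proof.
move=> eta0 N0 D0 DN bD bad.
have good i : eta <= b i -> D i <= eta^-1.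
  move=> bi; rewrite -[leRHS]mul1r ler_pdivlMr// mulrC.
  by apply: le_trans (bD i); rewrite ler_wpM2r.
have cst (n : seq nat) : \sum_(i <- n) eta^-1 = (size n)%:R / eta :> R.
  by rewrite big_const_seq count_predT iter_addr addr0 mulr_natl.
have [[i0 i0K bi0]|nobad] := pselect (exists2 i, (i < K)%N & b i < eta).
- rewrite (bigD1_seq i0)/= ?iota_uniq ?mem_index_iota//= lerD ?DN//.
  apply: (@le_trans _ _ (\sum_(0 <= i < K | i != i0) eta^-1)).
    rewrite big_nat_cond [leRHS]big_nat_cond ler_sum// => i /andP[/andP[_ iK] ii0].
    apply: good; rewrite leNgt; apply/negP => bi.
    exact: (bad i i0).
  apply: (@le_trans _ _ (\sum_(0 <= i < K) eta^-1)).
    by rewrite [leRHS](bigID (fun i => i != i0))/= lerDl sumr_ge0// => i _; rewrite invr_ge0 ltW.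
  by rewrite cst size_iota subn0.
- apply: (@le_trans _ _ (\sum_(0 <= i < K) eta^-1)).
    rewrite ler_sum_nat// => i /andP[_ iK]; apply: good; rewrite leNgt.
    by apply/negP => bi; apply: nobad; exists i.
  by rewrite cst size_iota subn0 lerDr.
Qed.

End ExponentialSums.

Section Runs.
Variable R : realType.
Implicit Types (dl W eps z s : R).

Lemma natr_dist_ge1 (i j : nat) : i != j -> 1 <= `|i%:R - j%:R| :> R.
Proof.
wlog ij : i j / (i < j)%N => [h|_].
  by case: (ltngtP i j) => // ij _; [|rewrite distrC]; apply: h => //; rewrite neq_ltn ij.
by rewrite distrC -natrB 1?ltnW// ger0_norm// ler1n subn_gt0.
Qed.

(** From one left endpoint to the next the distance is [1 + x], that is [p] with an error between 0
    and [tau], and these errors add up. *)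
Lemma gamma_seq_run (g1 : R) (x : nat -> R) (p tau : R) (b N k : nat) :
  (forall j, (j < N)%N -> p - 1 <= x (b + j)%N <= p - 1 + tau) -> (k <= N)%N ->
  0 <= gamma_seq g1 x (b + k) - (gamma_seq g1 x b + k%:R * p) <= k%:R * tau.
Proof.
move=> hx; elim: k => [|k IH] kN; first by rewrite addn0 !mul0r addr0 subrr lexx.
have /andP[h1 h2] := IH (ltnW kN); have /andP[h3 h4] := hx k kN.
by rewrite addnS /= -natr1 !mulrDl !mul1r; apply/andP; split; lra.
Qed.

(** Replacing the run by an exact arithmetic progression moves each phase by at most
    [2 * pi * W * (N%:R * tau)], and cosine is 1-Lipschitz. *)
Lemma run_sum_perturb (g1 : R) (x : nat -> R) (p tau : R) (b N : nat) W z s :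
  0 <= tau -> `|z| <= W ->
  (forall j, (j < N)%N -> p - 1 <= x (b + j)%N <= p - 1 + tau) ->
  `|\sum_(0 <= k < N) cos (2 * pi * z * gamma_seq g1 x (b + k) + s)| <=
  `|\sum_(0 <= k < N) cos (2 * pi * z * p * k%:R + (2 * pi * z * gamma_seq g1 x b + s))| +
  N%:R * (2 * pi * W * (N%:R * tau)).
Proof.
move=> tau0 zW hx; rewrite -lerBlDl; apply: le_trans (lerB_dist _ _) _.
rewrite -sumrB; apply: le_trans (ler_norm_sum _ _ _) _.
apply: (@le_trans _ _ (\sum_(0 <= k < N) (2 * pi * W * (N%:R * tau)))); last first.
  by rewrite sumr_const_nat subn0 -[leLHS]mulr_natl.
rewrite ler_sum_nat// => k /andP[_ kN]; apply: le_trans (cos_lipschitz _ _) _.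
have /andP[h1 h2] := gamma_seq_run g1 hx (ltnW kN).
set d := _ - (gamma_seq _ _ _ + _) in h1 h2.
have -> : 2 * pi * z * gamma_seq g1 x (b + k) + s -
  (2 * pi * z * p * k%:R + (2 * pi * z * gamma_seq g1 x b + s)) = 2 * pi * z * d.
  by rewrite /d; ring.
have pi0 := pi_gt0 R.
rewrite !normrM (ger0_norm h1) (ger0_norm (ler0n _ _)) (ger0_norm (ltW pi0)).
apply: ler_pM => //; first by rewrite !mulr_ge0// ltW.
- by rewrite ler_pM2l// mulr_gt0.
- by apply: le_trans h2 _; rewrite ler_wpM2r// ler_nat ltnW.
Qed.

(* The run consists of K stretches of N gaps, the i-th stretch being nearly an
   arithmetic progression of step 3 + i * sg.  For a frequency z with
   dl <= |z| <= W at most one stretch resonates, because two distinct steps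
   differ by a multiple of sg too small to make (i - j) * sg * z an integer. *)
Lemma run_exponential_sum dl W eps : 0 < dl -> dl <= 1 -> 1 <= W -> 0 < eps ->
  exists (L : nat) (q : nat -> R) (tau : R),
    [/\ (0 < L)%N, 0 < tau, forall m, 2 <= q m /\ q m + tau <= 3 &
      forall (g1 : R) (x : nat -> R) (a : nat),
        (forall m, (m < L)%N -> q m <= x (a + m)%N <= q m + tau) ->
        forall z s, dl <= `|z| -> `|z| <= W ->
        `|\sum_(0 <= m < L) cos (2 * pi * z * gamma_seq g1 x (a + m) + s)| <=
        eps * L%:R].
Proof.
move=> dl0 dl1 W1 eps0.
have pi0 := pi_gt0 R.
have W0 : 0 < W by lra.
(* A resonant stretch costs at most [N]; [K] is chosen so that this is at most [eps / 3] of all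
   [K * N] terms. *)
pose K := (Num.truncn (3 / eps)).+1.
have K0 : 0 < K%:R :> R by rewrite ltr0n.
have Keps : 3 <= K%:R * eps by rewrite -ler_pdivrMr// ltW// truncnS_gt.
(* For [|z| <= W] this keeps [(i - j) * sg * z] within 1/2 in absolute value, so that [pi] times it
   stays where sine is monotone. *)
pose sg : R := (2 * W * K%:R)^-1.
have sg0 : 0 < sg by rewrite invr_gt0 !mulr_gt0.
have sgE : K%:R * sg * W = 1 / 2 by rewrite /sg; field; rewrite !gt_eqF.
have sgK : K%:R * sg <= 1 / 2.
  by rewrite -sgE ler_peMr// mulr_ge0// ltW.
have sgdl : sg * dl <= 1 / 2.
  apply: le_trans sgK; rewrite mulrC ler_pM2r//.
  by apply: le_trans dl1 _; rewrite ler1n.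
(* [2 * eta] is a lower bound for the sine of [pi * (i - j) * sg * z] in absolute value when
   [i != j] and [dl <= |z| <= W]. *)
pose eta := sin (pi * (sg * dl)) / 2.
have eta0 : 0 < eta.
  rewrite divr_gt0// sin_gt0_pi// mulr_gt0 ?mulr_gt0//=.
  by rewrite -[ltRHS]mulr1 ltr_pM2l//; lra.
(* The stretches are made so long that nonresonant ones, at [1 / eta] each, use up at most another
   [eps / 3] of the [K * N] terms. *)
pose N := (Num.truncn (3 / (eps * eta))).+1.
have N0 : 0 < N%:R :> R by rewrite ltr0n.
have Neps : 3 <= N%:R * eps * eta.
  by rewrite -mulrA -ler_pdivrMr; [exact/ltW/truncnS_gt|exact: mulr_gt0].
(* [D * tau] bounds the phase error within a stretch and takes the last third of [eps]; the cap 1/2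
   on [tau], with [K * sg <= 1 / 2], keeps the pattern inside [2, 3]. *)
pose D : R := 2 * pi * W * N%:R.
have D0 : 0 < D by rewrite !mulr_gt0.
pose tau : R := Num.min (1 / 2) (eps / 3 / D).
have tau0 : 0 < tau by rewrite lt_min !divr_gt0.
have tau2 : tau <= 1 / 2 by rewrite ge_min lexx.
have tauD : D * tau <= eps / 3 by rewrite mulrC -ler_pdivlMr// ge_min lexx orbT.
(* A step [3 + i * sg] between left endpoints exceeds the value of [x] by 1, hence the 2. Capping at
   [K] keeps the bounds on [q] valid for every [m], also past the end of the run. *)
pose q (m : nat) : R := 2 + (minn (m %/ N) K)%:R * sg.
exists (K * N)%N, q, tau; split => //.
  move=> m; have h : (minn (m %/ N) K)%:R * sg <= K%:R * sg.
    by rewrite ler_pM2r// ler_nat geq_minr.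
  have h' : 0 <= (minn (m %/ N) K)%:R * sg by rewrite mulr_ge0// ltW.
  by rewrite /q; split; lra.
move=> g1 x a hx z s dlz zW.
pose p (i : nat) : R := 3 + i%:R * sg.
have hxi i j : (i < K)%N -> (j < N)%N -> p i - 1 <= x (a + i * N + j)%N <= p i - 1 + tau.
  move=> iK jN; have := hx (i * N + j)%N.
  rewrite (_ : (i * N + j < K * N)%N); last first.
    apply: (@leq_trans (i.+1 * N)); first by rewrite mulSnr ltn_add2l.
    by rewrite leq_mul2r iK orbT.
  rewrite addnA => /(_ isT); rewrite /q divnMDl// divn_small// addn0.
  by rewrite (minn_idPl (ltnW iK)) /p => /andP[h1 h2]; apply/andP; split; lra.
pose S i := \sum_(0 <= k < N) cos (2 * pi * z * p i * k%:R +
                        (2 * pi * z * gamma_seq g1 x (a + i * N) + s)).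
rewrite big_nat_mul; apply: le_trans (ler_norm_sum _ _ _) _.
apply: (@le_trans _ _ (\sum_(0 <= i < K) (`|S i| + N%:R * (D * tau)))).
  rewrite ler_sum_nat// => i /andP[_ iK].
  rewrite -{1}[(i * N)%N]add0n big_addn mulSn addnK.
  under eq_bigr => k _ do rewrite (addnC k) addnA.
  rewrite /D -(mulrA (2 * pi * W)).
  by apply: run_sum_perturb => //; [exact: ltW|move=> j jN; exact: hxi].
rewrite big_split/= sumr_const_nat subn0 -[X in _ + X]mulr_natl.
have SN i : `|S i| <= N%:R.
  by apply: le_trans (sum_cos_le _ _) _; rewrite size_iota subn0.
have Sb i : `|sin (pi * (p i * z))| * `|S i| <= 1.
  have := dirichlet_bound N (2 * pi * z * p i) (2 * pi * z * gamma_seq g1 x (a + i * N) + s).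
  by rewrite (_ : 2 * pi * z * p i / 2 = pi * (p i * z))//; field.
have sumS : \sum_(0 <= i < K) `|S i| <= N%:R + K%:R / eta.
  apply: (@sum_at_most_one_bad R K (fun i => `|S i|) (fun i => `|sin (pi * (p i * z))|)) => //.
  move=> i j iK jK ij bi bj.
  (* If the sines of both stretches were below [eta], the sine of the difference of their arguments
     would be below [2 * eta]. *)
  have : 2 * eta <= `|sin (pi * (p i * z) - pi * (p j * z))|.
    rewrite /eta mulrC divfK//; apply: sin_norm_ge.
    - by rewrite !mulr_ge0// ltW.
    - rewrite /p (_ : _ - _ = pi * (sg * ((i%:R - j%:R) * z))); last by ring.
      rewrite !normrM (gtr0_norm pi0) (gtr0_norm sg0) ler_pM2l// ler_pM2l//.
      rewrite -[leLHS]mul1r ler_pM// ?(ltW dl0)//.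
      exact: natr_dist_ge1.
    - rewrite /p (_ : _ - _ = pi * ((i%:R - j%:R) * sg * z)); last by ring.
      rewrite !normrM (gtr0_norm pi0) (gtr0_norm sg0) ler_pM2l//.
      apply: (@le_trans _ _ (K%:R * sg * W)); last by rewrite sgE mul1r.
      rewrite ler_pM// ?mulr_ge0// ?(ltW sg0)// ler_pM2r//.
      have : i%:R <= K%:R :> R by rewrite ler_nat ltnW.
      have : j%:R <= K%:R :> R by rewrite ler_nat ltnW.
      have : 0 <= i%:R :> R by [].
      have : 0 <= j%:R :> R by [].
      by rewrite ler_norml; lra.
  have := sin_diff_le (pi * (p i * z)) (pi * (p j * z)); lra.
have NK : N%:R + K%:R / eta <= K%:R * N%:R * (2 * (eps / 3)).
  rewrite (_ : _ * (2 * _) = K%:R * eps / 3 * N%:R + K%:R * (N%:R * eps / 3)); last by field.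
  rewrite lerD//; first by rewrite ler_peMl ?ler0n// ler_pdivlMr ?mul1r.
  by rewrite ler_pM2l// -[eta^-1]mul1r ler_pdivrMr// mulrAC ler_pdivlMr// mul1r.
rewrite natrM.
have : K%:R * (N%:R * (D * tau)) <= K%:R * N%:R * (eps / 3).
  by rewrite mulrA ler_pM2l// mulr_gt0.
have := sumS; lra.
Qed.

End Runs.

(** * Sums of inverse squares over separated sets *)

Section SeparatedSums.
Variable R : realType.
Implicit Types (dl : R) (A : seq R).

Lemma ler_sum_uniq_nat (s : seq nat) (F : nat -> R) (M : nat) : uniq s ->
  {in s, forall k, (k < M)%N} -> (forall k, 0 <= F k) ->
  \sum_(k <- s) F k <= \sum_(0 <= k < M) F k.
Proof.
move=> us sM F0; rewrite [leRHS](bigID (mem s))/= -[leLHS]addr0 lerD//; last exact: sumr_ge0.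
rewrite -[leRHS]big_filter le_eqVlt; apply/orP; left; apply/eqP; apply: perm_big.
apply: uniq_perm => //; first by rewrite filter_uniq ?iota_uniq.
move=> k; rewrite mem_filter/= mem_index_iota/=.
by apply/idP/andP => [ks|[]//]; split; rewrite ?sM.
Qed.

(** The correction [- M.+1%:R^-1] makes the induction close, by comparison with a telescoping sum.
    The term at 0 vanishes because the inverse of 0 is 0. *)
Lemma sum_inv_sqr_nat (M : nat) :
  \sum_(0 <= k < M.+2) (k%:R ^+ 2)^-1 <= 2 - M.+1%:R^-1 :> R.
Proof.
elim: M => [|M IH].
  by rewrite !big_nat_recr//= big_nil expr0n/= invr0 expr1n invr1; lra.
rewrite big_nat_recr//=; apply: le_trans (lerD IH (lexx _)) _.
rewrite -subr_ge0.
have m0 : 0 < M.+1%:R :> R by rewrite ltr0n.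
have -> : M.+2%:R = M.+1%:R + 1 :> R by rewrite -natr1.
set m := M.+1%:R in m0 *.
have -> : 2 - (m + 1)^-1 - (2 - m^-1 + (m + 1) ^- 2) = (m * (m + 1) ^+ 2)^-1.
  by field; rewrite !gt_eqF//; lra.
by rewrite invr_ge0 mulr_ge0 ?sqr_ge0// ltW.
Qed.

(** Truncating [a / dl] maps [A] injectively to positive integers [k] with [k * dl <= a], which
    reduces the sum to the one over integers. *)
Lemma sum_inv_sqr_pos dl A : 0 < dl -> uniq A ->
  {in A &, forall a b, a != b -> dl <= `|a - b|} -> {in A, forall a, dl <= a} ->
  \sum_(a <- A) (a ^+ 2)^-1 <= 2 / dl ^+ 2.
Proof.
move=> dl0 uA sepA geA; pose k (a : R) := Num.truncn (a / dl).
have kP a : a \in A -> [/\ (0 < k a)%N, (k a)%:R * dl <= a & a < (k a).+1%:R * dl].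
  move=> aA; have adl : 1 <= a / dl by rewrite ler_pdivlMr ?mul1r ?geA.
  have /andP[h1 h2] := truncn_itv (le_trans ler01 adl); split.
  - by rewrite truncn_gt0.
  - by rewrite -ler_pdivlMr.
  - by rewrite -ltr_pdivrMr.
have kinj : {in A &, injective k}.
  move=> a b aA bA kab; apply/eqP/negPn/negP => /(sepA _ _ aA bA).
  have [_ a1 a2] := kP _ aA; have [_ b1 b2] := kP _ bA.
  move: a1 a2; rewrite kab => a1 a2; apply/negP; rewrite -ltNge.
  by rewrite -natr1 mulrDl mul1r in a2 b2; rewrite ltr_norml; lra.
have uk : uniq (map k A) by rewrite map_inj_in_uniq.
rewrite [leRHS]mulrC.
apply: (@le_trans _ _ ((dl ^+ 2)^-1 * \sum_(n <- map k A) (n%:R ^+ 2)^-1)).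
  rewrite big_map mulr_sumr big_seq [leRHS]big_seq ler_sum// => a aA.
  have [k0 ka _] := kP _ aA.
  rewrite -invfM -exprMn lef_pV2 ?posrE ?exprn_gt0//.
  - by rewrite lerXn2r ?nnegrE// 1?mulrC// ?mulr_ge0 ?ler0n ?(ltW dl0)// (le_trans (ltW dl0)) ?geA.
  - by rewrite (lt_le_trans dl0) ?geA.
  - by rewrite mulr_gt0// ltr0n.
rewrite ler_pM2l ?invr_gt0 ?exprn_gt0//.
pose M := (\max_(n <- map k A) n)%N.
apply: le_trans (@ler_sum_uniq_nat _ (fun n => (n%:R ^+ 2)^-1) M.+2 uk _ _) _.
- move=> n nk; rewrite ltnS; apply: leqW.
  by rewrite /M (big_rem n)//= leq_maxl.
- by move=> n; rewrite invr_ge0 sqr_ge0.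
by apply: le_trans (sum_inv_sqr_nat M) _; rewrite gerBl invr_ge0.
Qed.

Lemma sum_inv_sqr_separated dl A : 0 < dl -> uniq A ->
  {in A &, forall a b, a != b -> dl <= `|a - b|} ->
  {in A, forall a, dl <= `|a|} ->
  \sum_(a <- A) (a ^+ 2)^-1 <= 4 / dl ^+ 2.
Proof.
move=> dl0 uA sepA geA; rewrite (bigID (fun a => 0 <= a))/=.
have -> : 4 / dl ^+ 2 = 2 / dl ^+ 2 + 2 / dl ^+ 2 by rewrite -mulrDl; congr (_ / _); ring.
apply: lerD.
- rewrite -big_filter; apply: sum_inv_sqr_pos; rewrite ?filter_uniq//.
  + by move=> a b; rewrite !mem_filter => /andP[_ aA] /andP[_ bA]; exact: sepA.
  + by move=> a; rewrite mem_filter => /andP[a0 /geA]; rewrite ger0_norm.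
- rewrite -big_filter; under eq_bigr do rewrite -sqrrN.
  rewrite -(big_map (@GRing.opp R) xpredT (fun a => (a ^+ 2)^-1)).
  apply: sum_inv_sqr_pos => //.
  + by rewrite map_inj_uniq ?filter_uniq//; exact: oppr_inj.
  + move=> a b /mapP[a' + ->] /mapP[b' + ->].
    rewrite !mem_filter => /andP[_ aA] /andP[_ bA]; rewrite (inj_eq oppr_inj) => ab.
    by rewrite -opprD normrN sepA.
  + move=> a /mapP[a' + ->]; rewrite mem_filter -ltNge => /andP[a0 /geA].
    by rewrite ltr0_norm.
Qed.

End SeparatedSums.

(** * Fourier transforms of bounded functions with bounded support *)

Section SupportedFunctions.
Variables (R : realType) (D : set R) (r : R).
Hypothesis r_ge0 : 0 <= r.
Hypothesis D_bounded : forall t, D t -> `|t| <= r.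

Local Notation mu := (@lebesgue_measure R).

(** Work on the Fourier side stays in this class: its members are integrable because [D] is bounded,
    and the single constant [B] controls their integrals. *)
Definition bounded_on (B : R) (h : R -> R) : Prop :=
  [/\ measurable_fun setT h, forall t, `|h t| <= B & forall t, ~ D t -> h t = 0].

Lemma bounded_on_ge0 B h : bounded_on B h -> 0 <= B.
Proof. by case=> _ hB _; apply: le_trans (hB 0). Qed.

Lemma bounded_on_le B B' h : B <= B' -> bounded_on B h -> bounded_on B' h.
Proof. by move=> BB' [mh hB h0]; split=> // t; exact: le_trans (hB t) BB'. Qed.

Lemma bounded_onD B1 B2 h1 h2 : bounded_on B1 h1 -> bounded_on B2 h2 ->
  bounded_on (B1 + B2) (fun t => h1 t + h2 t).
Proof.
move=> [mh1 hB1 h01] [mh2 hB2 h02]; split.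
- exact: measurable_funD.
- by move=> t; apply: le_trans (ler_normD _ _) _; exact: lerD.
- by move=> t nD; rewrite h01// h02// addr0.
Qed.

Lemma bounded_onM (B C : R) (c h : R -> R) : measurable_fun setT c -> (forall t, `|c t| <= C) ->
  bounded_on B h -> bounded_on (C * B) (fun t => c t * h t).
Proof.
move=> mc cC [mh hB h0]; split.
- exact: measurable_funM.
- by move=> t; rewrite normrM ler_pM.
- by move=> t nD; rewrite h0// mulr0.
Qed.

Lemma bounded_onN B h : bounded_on B h -> bounded_on B (fun t => - h t).
Proof.
move=> [mh hB h0]; split; first exact: measurableT_comp.
- by move=> t; rewrite normrN.
- by move=> t nD; rewrite h0// oppr0.
Qed.

Lemma le_patch_itv B h t : bounded_on B h -> `|h t| <= (cst B \_ `[- r, r]) t.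
Proof.
move=> hh; have [mh hB h0] := hh; rewrite patchE; case: ifPn => [_|]; first exact: hB.
rewrite notin_setE/= in_itv/= -ler_norml => nr; rewrite h0 ?normr0//.
by move=> /D_bounded.
Qed.

Lemma lebesgue_measure_sym_itv : mu `[- r, r]%classic = (2 * r)%:E.
Proof.
rewrite lebesgue_measure_itv/= lte_fin; case: ifPn => [_|].
  by rewrite -EFinB; congr EFin; lra.
move=> h; have -> : r = 0 by move: h; rewrite -leNgt; have := r_ge0; lra.
by rewrite mulr0.
Qed.

Lemma integrable_cst_itv (B : R) : mu.-integrable setT (EFin \o (cst B \_ `[- r, r])).
Proof.
rewrite -restrict_EFin; apply: (integrable_mkcond _ _).1 => //.
apply: measurable_bounded_integrable => //.
- by change (mu `[(- r)%R, r]%classic < +oo)%E; rewrite lebesgue_measure_sym_itv ltry.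
- by exists `|B|; split; rewrite ?num_real// => M BM t _ /=; exact: ltW.
Qed.

Lemma bounded_on_integrable B h : bounded_on B h -> mu.-integrable setT (EFin \o h).
Proof.
move=> hh; have [mh hB h0] := hh.
apply: le_integrable (integrable_cst_itv B) => //; first exact/measurable_EFinP.
move=> t _ /=; rewrite lee_fin; apply: le_trans (le_patch_itv t hh) _.
exact: ler_norm.
Qed.

Lemma bounded_on_Rintegral_le B h : bounded_on B h ->
  `|\int[mu]_t h t| <= B * (2 * r).
Proof.
move=> hh; have [mh hB h0] := hh; have B0 := bounded_on_ge0 hh.
apply: le_trans (le_normr_Rintegral _ (bounded_on_integrable hh)) _ => //.
apply: (@le_trans _ _ (\int[mu]_t (cst B \_ `[- r, r]) t)).
  apply: le_Rintegral => //; last by move=> t _; exact: le_patch_itv.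
  - have : mu.-integrable setT (abse \o (EFin \o h)).
      by apply: integrable_abse; exact: bounded_on_integrable hh.
    by [].
  - exact: integrable_cst_itv.
rewrite -Rintegral_mkcond Rintegral_cst// ler_wpM2l//.
by change (fine (mu `[- r, r]%classic) <= 2 * r); rewrite lebesgue_measure_sym_itv.
Qed.

Definition cbounded_on (B : R) (F : R -> R[i]) : Prop :=
  bounded_on B (fun t => complex.Re (F t)) /\ bounded_on B (fun t => complex.Im (F t)).

Definition fourier (F : R -> R[i]) (x : R) : R[i] :=
  cintegral (fun t => expi (2 * pi * t * x) * F t).

Lemma Re_expi_mul th (z : R[i]) :
  complex.Re (expi th * z) = cos th * complex.Re z - sin th * complex.Im z.
Proof. by case: z. Qed.

Lemma Im_expi_mul th (z : R[i]) :
  complex.Im (expi th * z) = cos th * complex.Im z + sin th * complex.Re z.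
Proof. by case: z. Qed.

Lemma measurable_cos_lin x : measurable_fun setT (fun t : R => cos (2 * pi * t * x)).
Proof.
apply: continuous_measurable_fun => t; apply: (@continuous_comp _ _ _ (fun t => 2 * pi * t * x)).
  apply: cvgMr_tmp; exact: mulrl_continuous.
exact: continuous_cos.
Qed.

Lemma measurable_sin_lin x : measurable_fun setT (fun t : R => sin (2 * pi * t * x)).
Proof.
apply: continuous_measurable_fun => t; apply: (@continuous_comp _ _ _ (fun t => 2 * pi * t * x)).
  apply: cvgMr_tmp; exact: mulrl_continuous.
exact: continuous_sin.
Qed.

Lemma cbounded_on_expi B F x : cbounded_on B F ->
  cbounded_on (B + B) (fun t => expi (2 * pi * t * x) * F t).
Proof.
move=> [bRe bIm].
have bcos h : bounded_on B h -> bounded_on B (fun t => cos (2 * pi * t * x) * h t).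
  move=> bh; rewrite -[B]mul1r; apply: bounded_onM => //; first exact: measurable_cos_lin.
  by move=> t; exact: cos_max.
have bsin h : bounded_on B h -> bounded_on B (fun t => sin (2 * pi * t * x) * h t).
  move=> bh; rewrite -[B]mul1r; apply: bounded_onM => //; first exact: measurable_sin_lin.
  by move=> t; exact: sin_max.
split.
- under eq_fun do rewrite Re_expi_mul.
  by apply: bounded_onD; [exact: bcos|apply: bounded_onN; exact: bsin].
- under eq_fun do rewrite Im_expi_mul.
  by apply: bounded_onD; [exact: bcos|exact: bsin].
Qed.

Lemma cbounded_onD B1 B2 F1 F2 : cbounded_on B1 F1 -> cbounded_on B2 F2 ->
  cbounded_on (B1 + B2) (fun t => F1 t + F2 t).
Proof.
move=> [r1 i1] [r2 i2]; split.
- rewrite (_ : (fun t => complex.Re _) = (fun t => complex.Re (F1 t) + complex.Re (F2 t))).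
    exact: bounded_onD.
  by apply/funext => t; case: (F1 t); case: (F2 t).
- rewrite (_ : (fun t => complex.Im _) = (fun t => complex.Im (F1 t) + complex.Im (F2 t))).
    exact: bounded_onD.
  by apply/funext => t; case: (F1 t); case: (F2 t).
Qed.

Lemma cintegralD B1 B2 G1 G2 : cbounded_on B1 G1 -> cbounded_on B2 G2 ->
  cintegral (fun t => G1 t + G2 t) = cintegral G1 + cintegral G2.
Proof.
move=> [r1 i1] [r2 i2]; rewrite /cintegral.
rewrite (_ : (fun t => complex.Re _) = (fun t => complex.Re (G1 t) + complex.Re (G2 t))); last first.
  by apply/funext => t; case: (G1 t); case: (G2 t).
rewrite (_ : (fun t => complex.Im _) = (fun t => complex.Im (G1 t) + complex.Im (G2 t))); last first.
  by apply/funext => t; case: (G1 t); case: (G2 t).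
by rewrite !RintegralD//; (exact: bounded_on_integrable r1 || exact: bounded_on_integrable r2
  || exact: bounded_on_integrable i1 || exact: bounded_on_integrable i2).
Qed.

Lemma fourierD B1 B2 F1 F2 x : cbounded_on B1 F1 -> cbounded_on B2 F2 ->
  fourier (fun t => F1 t + F2 t) x = fourier F1 x + fourier F2 x.
Proof.
move=> /(cbounded_on_expi x) b1 /(cbounded_on_expi x) b2.
rewrite /fourier -(cintegralD b1 b2); congr cintegral.
by apply/funext => t; rewrite mulrDr.
Qed.

(** Real and imaginary parts are estimated separately, so this norm, still submultiplicative,
    replaces the modulus. *)
Definition norm1 (z : R[i]) : R := `|complex.Re z| + `|complex.Im z|.

Lemma fourier_bound B F x : cbounded_on B F -> norm1 (fourier F x) <= 8 * r * B.
Proof.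
move=> /(cbounded_on_expi x)[bre bim]; rewrite /norm1 /fourier /cintegral/=.
apply: le_trans (lerD (bounded_on_Rintegral_le bre) (bounded_on_Rintegral_le bim)) _.
by lra.
Qed.

Lemma fourier_W_space alpha (S : set R) B F : D `<=` S -> 0 <= alpha ->
  cbounded_on B F -> W_space alpha S (fourier F).
Proof.
move=> DS alpha0 [bre bim]; have [mre reB re0] := bre; have [mim imB im0] := bim.
have B0 := bounded_on_ge0 bre.
exists F; split => //; last first.
  apply: aeW => t St; apply/eqP; rewrite eq_complex re0 ?im0 ?eqxx// => /DS//.
pose h t := (1 + `|t| `^ (2 * alpha)) * cnorm2 (F t).
have bh : bounded_on ((1 + r `^ (2 * alpha)) * (B ^+ 2 + B ^+ 2)) h.
  split.
  - apply: measurable_funM.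
      apply: measurable_funD => //.
      by apply: (measurableT_comp (measurable_powR _)) => //; exact: normr_measurable.
    by apply: measurable_funD; apply: measurable_funX.
  - move=> t; have [Dt|nDt] := pselect (D t); last first.
      rewrite /h /cnorm2 re0// im0// expr0n/= addr0 mulr0 normr0.
      by rewrite mulr_ge0// addr_ge0 ?powR_ge0// sqr_ge0.
    rewrite /h normrM ler_pM//.
      rewrite ger0_norm ?addr_ge0 ?powR_ge0// lerD2l.
      by apply: ge0_ler_powR; rewrite ?nnegrE ?mulr_ge0// D_bounded.
    rewrite /cnorm2 ger0_norm ?addr_ge0 ?sqr_ge0// lerD//.
      by rewrite -[leLHS]real_normK ?num_real// lerXn2r ?nnegrE.
    by rewrite -[leLHS]real_normK ?num_real// lerXn2r ?nnegrE.
  - by move=> t nDt; rewrite /h /cnorm2 re0// im0// expr0n/= addr0 mulr0.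
have /integrableP[_] := bounded_on_integrable bh.
apply: le_lt_trans; rewrite le_eqVlt; apply/orP; left; apply/eqP.
apply: eq_integral => t _ /=; congr EFin; rewrite [RHS]ger0_norm//.
by rewrite mulr_ge0// addr_ge0 ?powR_ge0 ?sqr_ge0.
Qed.

Lemma geometric_series_tail (u : nat -> R) (C q : R) : 0 < q < 1 -> 0 <= C ->
  (forall k, `|u k| <= C * q ^+ k) ->
  cvgn (series u) /\
  forall n, `|limn (series u) - series u n| <= C / (1 - q) * q ^+ n.
Proof.
move=> /andP[q0 q1] C0 uC.
have nq : `|q| < 1 by rewrite gtr0_norm.
have cvgu : cvgn (series u).
  apply: normed_cvg; apply: (@series_le_cvg _ _ (geometric C q)) => //.
  - by move=> k /=.
  - by move=> k; rewrite /geometric/= mulr_ge0// exprn_ge0// ltW.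
  - exact: is_cvg_geometric_series.
split=> // n.
have cv : `|series u m - series u n| @[m --> \oo] --> `|limn (series u) - series u n|.
  by apply: cvg_norm; apply: cvgB => //; exact: cvg_cst.
apply: (cvgr_to_le cv); exists n => // m /= nm.
rewrite sub_series_geq//; apply: le_trans (ler_norm_sum _ _ _) _.
apply: (@le_trans _ _ (\sum_(n <= k < n + (m - n)) C * q ^+ k)).
  by rewrite subnKC// ler_sum.
rewrite -mulr_sumr geometric_partial_tail -mulrA ler_wpM2l//.
by rewrite [leRHS]mulrC; apply: geometric_le_lim => //; rewrite exprn_ge0// ltW.
Qed.

Lemma Re_sum (I : Type) (s : seq I) (f : I -> R[i]) :
  complex.Re (\sum_(i <- s) f i) = \sum_(i <- s) complex.Re (f i).
Proof. by apply: big_morph => // -[a b] [a' b']. Qed.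

Lemma Im_sum (I : Type) (s : seq I) (f : I -> R[i]) :
  complex.Im (\sum_(i <- s) f i) = \sum_(i <- s) complex.Im (f i).
Proof. by apply: big_morph => // -[a b] [a' b']. Qed.

Lemma ReB (z1 z2 : R[i]) : complex.Re (z1 - z2) = complex.Re z1 - complex.Re z2.
Proof. by case: z1; case: z2. Qed.

Lemma ImB (z1 z2 : R[i]) : complex.Im (z1 - z2) = complex.Im z1 - complex.Im z2.
Proof. by case: z1; case: z2. Qed.

Lemma bounded_on0 : bounded_on 0 (fun=> 0).
Proof. by split => // t; rewrite normr0. Qed.

Lemma fourier_sum (I : Type) (s : seq I) (Bs : I -> R) (Fs : I -> R -> R[i]) :
  (forall i, cbounded_on (Bs i) (Fs i)) ->
  cbounded_on (\sum_(i <- s) Bs i) (fun t => \sum_(i <- s) Fs i t) /\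
  forall x, fourier (fun t => \sum_(i <- s) Fs i t) x = \sum_(i <- s) fourier (Fs i) x.
Proof.
move=> bF; elim: s => [|i s [IH1 IH2]].
  rewrite big_nil; split.
    by split; (rewrite (_ : (fun t => _) = fun=> 0); [exact: bounded_on0|apply/funext => t; rewrite big_nil]).
  move=> x; rewrite big_nil /fourier /cintegral; apply/eqP; rewrite eq_complex/=.
  under eq_Rintegral do rewrite big_nil mulr0/=.
  rewrite Rintegral_cst//= mul0r eqxx/=.
  under eq_Rintegral do rewrite big_nil mulr0/=.
  by rewrite Rintegral_cst//= mul0r.
have FE : (fun t => \sum_(j <- i :: s) Fs j t) = (fun t => Fs i t + \sum_(j <- s) Fs j t).
  by apply/funext => t; rewrite big_cons.
rewrite FE big_cons; split; first exact: cbounded_onD.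
by move=> x; rewrite big_cons -IH2 -(fourierD x (bF i) IH1).
Qed.

(** The series is summed pointwise. Its tail is again bounded with support in [D], of geometric
    size, so [fourier_bound] gives the estimate without a limit under the integral. *)
Lemma fourier_series (Fk : nat -> R -> R[i]) (C q : R) : 0 < q < 1 -> 0 <= C ->
  (forall k, cbounded_on (C * q ^+ k) (Fk k)) ->
  exists2 F, cbounded_on (C / (1 - q)) F &
    forall x n, norm1 (fourier F x - \sum_(k < n) fourier (Fk k) x) <=
                8 * r * (C / (1 - q) * q ^+ n).
Proof.
move=> q01 C0 bF; have [q0 q1] := andP q01.
pose uR k t := complex.Re (Fk k t); pose uI k t := complex.Im (Fk k t).
pose F t : R[i] := (limn (series (uR^~ t)) +i* limn (series (uI^~ t)))%C.
have boundedP (u : nat -> R -> R) n : (forall k, bounded_on (C * q ^+ k) (u k)) ->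
    bounded_on (C / (1 - q) * q ^+ n)
      (fun t => limn (series (u^~ t)) - \sum_(k < n) u k t).
  move=> bu; have ub k t : `|u k t| <= C * q ^+ k by have [] := bu k.
  have tl t := geometric_series_tail q01 C0 (fun k => ub k t).
  have mu_ k : measurable_fun setT (u k) by have [] := bu k.
  split.
  - apply: measurable_funB; last exact: measurable_sum.
    apply: (@measurable_fun_cvg _ _ _ _ (fun n t => series (u^~ t) n)).
      by move=> m; apply: measurable_sum.
    by move=> t _; exact: (tl t).1.
  - by move=> t; have := (tl t).2 n; rewrite /series/= big_mkord.
  - move=> t nD; have u0 k : u k t = 0 by have [_ _ ->] := bu k.
    rewrite big1 => [|k _]; last exact: u0.
    rewrite subr0 (_ : series _ = cst 0) ?lim_cst//.
    by apply/funext => m; rewrite /series/= big1.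
have tail n : cbounded_on (C / (1 - q) * q ^+ n)
   (fun t => F t - \sum_(k < n) Fk k t).
  split.
  - under eq_fun do rewrite ReB Re_sum.
    by apply: (boundedP uR) => k; have [] := bF k.
  - under eq_fun do rewrite ImB Im_sum.
    by apply: (boundedP uI) => k; have [] := bF k.
have tail0 : cbounded_on (C / (1 - q)) F.
  have := tail 0%N; rewrite expr0 mulr1; under eq_fun do rewrite big_ord0 subr0.
  by [].
exists F => // x n.
have [bS <-] := fourier_sum (index_enum 'I_n) (fun k : 'I_n => bF k).
have FE : F = (fun t => (F t - \sum_(k < n) Fk k t) + \sum_(k < n) Fk k t).
  by apply/funext => t; rewrite subrK.
rewrite {1}FE (fourierD x (tail n) bS) addrK.
exact: fourier_bound (tail n).
Qed.

End SupportedFunctions.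

(** * Interpolation by successive corrections *)

Section Greedy.
Variable R : realType.
Implicit Types (z : R[i]).

Lemma norm1_ge0 z : 0 <= norm1 z.
Proof. exact: addr_ge0. Qed.

Lemma norm10 : norm1 (0 : R[i]) = 0.
Proof. by rewrite /norm1/= normr0 addr0. Qed.

Lemma norm1D z1 z2 : norm1 (z1 + z2) <= norm1 z1 + norm1 z2.
Proof.
case: z1 z2 => [a b] [c d]; rewrite /norm1/=.
have := ler_normD a c; have := ler_normD b d; lra.
Qed.

Lemma norm1N z : norm1 (- z) = norm1 z.
Proof. by case: z => [a b]; rewrite /norm1/= !normrN. Qed.

Lemma norm1M z1 z2 : norm1 (z1 * z2) <= norm1 z1 * norm1 z2.
Proof.
case: z1 z2 => [a b] [c d]; rewrite /norm1/=.
have := ler_normB (a * c) (b * d); have := ler_normD (a * d) (b * c).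
by rewrite !normrM; nra.
Qed.

Lemma norm1_sum (I : Type) (s : seq I) (f : I -> R[i]) :
  norm1 (\sum_(i <- s) f i) <= \sum_(i <- s) norm1 (f i).
Proof.
elim: s => [|i s IH]; first by rewrite !big_nil norm10.
by rewrite !big_cons; apply: le_trans (norm1D _ _) _; rewrite lerD2l.
Qed.

Lemma norm1_eq0 z : norm1 z <= 0 -> z = 0.
Proof.
move=> h; have a0 := normr_ge0 (complex.Re z); have b0 := normr_ge0 (complex.Im z).
apply/eqP; rewrite eq_complex -!normr_le0 /=.
by move: h; rewrite /norm1 => h; apply/andP; split; lra.
Qed.

Variables (D : set R) (r : R).
Hypothesis r_ge0 : 0 <= r.
Hypothesis D_bounded : forall t, D t -> `|t| <= r.
Variables (atom : R[i] -> R -> R -> R[i]) (g : R -> R[i]) (C dl : R).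
Hypothesis C_ge0 : 0 <= C.
Hypothesis atom_bounded : forall z l, cbounded_on D (C * norm1 z) (atom z l).
Hypothesis fourier_atom : forall z l x, fourier (atom z l) x = z * g (x - l).
Hypothesis g0 : g 0 = 1.
Hypothesis g_small : forall A : seq R, uniq A ->
  {in A &, forall a b, a != b -> dl <= `|a - b|} -> {in A, forall a, dl <= `|a|} ->
  \sum_(a <- A) norm1 (g a) <= 1 / 2.
Variable L : set R.
Hypothesis L_sep : forall a b, L a -> L b -> a != b -> dl <= `|a - b|.

(** The l1 bound is expressed through finite subsets, so no enumeration of [L] enters. *)
Definition l1_le (y : R -> R[i]) (rho : R) : Prop :=
  forall A : seq R, uniq A -> (forall a, a \in A -> L a) ->
    \sum_(a <- A) norm1 (y a) <= rho.

(** Take [B] with sum within [e] of the supremum over finite subsets; adding a disjoint [A] cannot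
    exceed that supremum. *)
Lemma l1_capture y rho e : l1_le y rho -> 0 < e ->
  exists B : seq R, [/\ uniq B, forall b, b \in B -> L b &
    forall A, uniq A -> (forall a, a \in A -> L a) -> (forall a, a \in A -> a \notin B) ->
      \sum_(a <- A) norm1 (y a) <= e].
Proof.
move=> yrho e0.
pose V : set R := [set v | exists A : seq R, [/\ uniq A, forall a, a \in A -> L a &
  v = \sum_(a <- A) norm1 (y a)]].
have supV : has_sup V.
  split; first by exists 0, [::]; split => //; rewrite big_nil.
  by exists rho => _ [A [uA LA ->]]; exact: yrho.
have [_ [B [uB LB ->]] hB] := sup_adherent e0 supV.
exists B; split => // A uA LA AB.
have : \sum_(a <- A ++ B) norm1 (y a) <= sup V.
  apply: ub_le_sup; first exact: supV.2.
  exists (A ++ B); split => //.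
  - rewrite cat_uniq uA uB andbT/=; apply/hasPn => b bB.
    by apply/negP => /AB; rewrite bB.
  - by move=> a; rewrite mem_cat => /orP[/LA|/LB].
rewrite big_cat/=; lra.
Qed.

(** Correct at the points of a finite [B] carrying all but [rho / 4] of the mass. On [B] the
    diagonal term cancels [y] since [g 0 = 1]; the off-diagonal terms cost at most half the mass, so
    [rho / 4 + rho / 2] remains. *)
Lemma greedy_step y rho : 0 < rho -> l1_le y rho ->
  exists2 F, cbounded_on D (C * rho) F &
    l1_le (fun x => y x - fourier F x) (3 / 4 * rho).
Proof.
move=> rho0 yrho; have rho4 : 0 < rho / 4 by rewrite divr_gt0.
have [B [uB LB hB]] := l1_capture yrho rho4.
have [bF fF] := fourier_sum r_ge0 D_bounded B (fun l => atom_bounded (y l) l).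
exists (fun t => \sum_(l <- B) atom (y l) l t).
  have BC : \sum_(l <- B) C * norm1 (y l) <= C * rho.
    by rewrite -mulr_sumr ler_wpM2l// yrho.
  by case: bF => [b1 b2]; split; [exact: bounded_on_le b1|exact: bounded_on_le b2].
move=> A uA LA.
(* [h a l] bounds the off-diagonal effect at [a] of the correction centred at [l]. *)
pose h a l : R := if l == a then 0 else norm1 (y l) * norm1 (g (a - l)).
have pt a : norm1 (y a - fourier (fun t => \sum_(l <- B) atom (y l) l t) a) <=
    (if a \in B then 0 else norm1 (y a)) + \sum_(l <- B) h a l.
  rewrite fF; under eq_bigr do rewrite fourier_atom.
  case: ifPn => aB.
  - rewrite (bigD1_seq a)//= subrr g0 mulr1 opprD addNKr norm1N add0r.
    rewrite [leRHS](bigD1_seq a)//= {1}/h eqxx add0r -big_filter -[leRHS]big_filter.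
    apply: le_trans (norm1_sum _ _) _; rewrite big_seq [leRHS]big_seq ler_sum// => l.
    by rewrite mem_filter /h => /andP[/negbTE -> _]; exact: norm1M.
  - apply: le_trans (norm1D _ _) _; rewrite norm1N lerD2l.
    apply: le_trans (norm1_sum _ _) _; rewrite big_seq [leRHS]big_seq ler_sum// => l lB.
    rewrite /h ifN; first exact: norm1M.
    by apply: contraNneq aB => <-.
apply: le_trans (ler_sum _ (fun a _ => pt a)) _; rewrite big_split/=.
have -> : 3 / 4 * rho = rho / 4 + rho / 2 by field.
apply: lerD.
  rewrite (eq_bigr (fun a => if a \notin B then norm1 (y a) else 0)) => [|a _]; last first.
    by rewrite if_neg.
  rewrite -big_mkcond -big_filter; apply: hB.
  - exact: filter_uniq.
  - by move=> a; rewrite mem_filter => /andP[_ /LA].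
  - by move=> a; rewrite mem_filter => /andP[].
(* For fixed [l], the differences [a - l] with [a != l] are separated and at distance at least [dl]
   from 0, so [g_small] bounds the inner sum. *)
rewrite exchange_big/=.
apply: (@le_trans _ _ (\sum_(l <- B) norm1 (y l) / 2)); last first.
  by rewrite -mulr_suml ler_pM2r// yrho.
rewrite big_seq [leRHS]big_seq ler_sum// => l lB.
rewrite (eq_bigr (fun a => if a != l then norm1 (y l) * norm1 (g (a - l)) else 0)); last first.
  by move=> a _; rewrite /h eq_sym if_neg.
rewrite -big_mkcond -big_filter -mulr_sumr ler_wpM2l ?norm1_ge0//.
rewrite -(big_map (fun a => a - l) xpredT (fun b => norm1 (g b))).
rewrite -[leRHS]mul1r; apply: g_small.
- by rewrite map_inj_uniq ?filter_uniq//; exact: addIr.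
- move=> _ _ /mapP[a + ->] /mapP[b + ->]; rewrite !mem_filter => /andP[_ aA] /andP[_ bA].
  rewrite (inj_eq (addIr _)) opprB addrA subrK => ab.
  by apply: L_sep => //; exact: LA.
- move=> _ /mapP[a + ->]; rewrite mem_filter => /andP[al aA].
  by apply: L_sep => //; [exact: LA|exact: LB].
Qed.

(** After n steps the residual has l1 norm at most (3/4)^n, and the next correction has size at most
    C (3/4)^n, so the corrections sum to a function interpolating [y] exactly. *)
Lemma greedy_interpolation y : l1_le y 1 ->
  exists B F, cbounded_on D B F /\ forall l, L l -> fourier F l = y l.
Proof.
move=> y1.
(* Choice requires a correction for every pair; where the step does not apply, the zero function is
   a default value. *)
have stepP (p : R * (R -> R[i])) : exists F, 0 < p.1 -> l1_le p.2 p.1 ->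
    cbounded_on D (C * p.1) F /\ l1_le (fun x => p.2 x - fourier F x) (3 / 4 * p.1).
  have [[p0 p1]|np] := pselect (0 < p.1 /\ l1_le p.2 p.1).
    by have [F bF lF] := greedy_step p0 p1; exists F.
  by exists (fun=> 0) => p0 p1; exfalso; exact: np.
have [st stP] := choice stepP.
pose next (p : R * (R -> R[i])) := (3 / 4 * p.1, fun x => p.2 x - fourier (st p) x).
pose P n := iter n next (1, y).
have P1 n : (P n).1 = (3 / 4) ^+ n.
  by elim: n => [|n IH]; rewrite ?expr0// /P iterS /= -/(P n) IH exprS.
have P10 n : 0 < (P n).1 by rewrite P1 exprn_gt0.
have P2 n : l1_le (P n).2 (P n).1.
  by elim: n => [|n IH]//; exact: (stP (P n) (P10 n) IH).2.
have bst n : cbounded_on D (C * (3 / 4) ^+ n) (st (P n)).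
  by rewrite -P1; exact: (stP (P n) (P10 n) (P2 n)).1.
have P2E n x : (P n).2 x = y x - \sum_(k < n) fourier (st (P k)) x.
  elim: n => [|n IH]; first by rewrite big_ord0 subr0.
  by rewrite big_ord_recr/= -/(P n) IH opprD addrA.
have q01 : 0 < (3 / 4 : R) < 1 by apply/andP; split; lra.
have [F bF hF] := fourier_series r_ge0 D_bounded q01 C_ge0 bst.
exists (C / (1 - 3 / 4)), F; split => // l Ll.
pose M := 8 * r * (C / (1 - 3 / 4)) + 1.
have hM n : norm1 (fourier F l - y l) <= M * (3 / 4) ^+ n.
  have -> : fourier F l - y l =
     (fourier F l - \sum_(k < n) fourier (st (P k)) l) + - (P n).2 l.
    by rewrite P2E opprB addrA subrK.
  apply: le_trans (norm1D _ _) _; rewrite norm1N.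
  have := hF l n; have : norm1 ((P n).2 l) <= (3 / 4) ^+ n.
    rewrite -P1; have := P2 n [:: l] isT; rewrite big_seq1; apply.
    by move=> a; rewrite inE => /eqP ->.
  by rewrite /M; lra.
apply/eqP; rewrite -subr_eq0; apply/eqP/norm1_eq0.
have cvg0 : M * (3 / 4) ^+ n @[n --> \oo] --> (M * 0 : R).
  apply: cvgM; first exact: cvg_cst.
  by apply: cvg_expr; rewrite gtr0_norm//; lra.
rewrite mulr0 in cvg0; apply: (cvgr_to_ge cvg0).
by apply: nearW => n; exact: hM.
Qed.

End Greedy.

(** * The kernel attached to finitely many components *)

Section Kernel.
Variable R : realType.
Local Notation mu := (@lebesgue_measure R).

Definition bump_at (c : R) : R -> R := (fun t => bump_poly (t - c)) \_ `[c, c + 1].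

(* The phase s = - pi / 2 turns the cosine into a sine, so that both parts of the
   transform are instances of one formula. *)
Definition bump_cos (c z s : R) : R := \int[mu]_t (bump_at c t * cos (2 * pi * z * t + s)).

Lemma bump_cosE c z s :
  bump_cos c z s = \int[mu]_(t in `[c, c + 1]) (bump_poly (t - c) * cos (2 * pi * z * t + s)).
Proof.
rewrite [RHS]Rintegral_mkcond; apply: eq_Rintegral => t _.
by rewrite /bump_at !patchE; case: ifP; rewrite ?mul0r.
Qed.

Lemma bump_cos_freq0 c : bump_cos c 0 0 = 1.
Proof.
rewrite bump_cosE -[RHS](Rintegral_bump c); apply: eq_Rintegral => t _.
by rewrite mulr0 mul0r addr0 cos0 mulr1.
Qed.

Lemma bump_sin_freq0 c : bump_cos c 0 (- (pi / 2)) = 0.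
Proof.
rewrite bump_cosE (@eq_Rintegral _ _ _ mu _ (fun=> 0)) => [|t _].
  by rewrite Rintegral_cst// mul0r.
by rewrite mulr0 mul0r add0r cosN cos_pihalf mulr0.
Qed.

Lemma bump_at_bounded (D : set R) c : `[c, c + 1]%classic `<=` D ->
  bounded_on D 30 (bump_at c).
Proof.
move=> cD; split.
- apply: (measurable_restrictT _ _).1 => //.
  apply: measurable_funTS; apply: continuous_measurable_fun.
  exact: continuous_bump_poly.
- move=> t; rewrite /bump_at patchE; case: ifPn => [|_]; last by rewrite normr0.
  rewrite inE/= in_itv/= => /andP[ct tc]; rewrite /bump_poly.
  have u0 : 0 <= t - c by lra.
  have u1 : t - c <= 1 by lra.
  rewrite ger0_norm; last by rewrite mulr_ge0// mulr_ge0 ?sqr_ge0.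
  rewrite -[leRHS]mulr1 ler_pM2l//.
  by rewrite mulr_ile1 ?sqr_ge0// exprn_ile1//; lra.
- move=> t nD; rewrite /bump_at patchE ifN//; apply/negP; rewrite inE => /cD.
  exact: nD.
Qed.

Definition node_atom (k c : R) (z : R[i]) (l t : R) : R[i] :=
  (k * bump_at c t)%:C%C * (expi (2 * pi * t * - l) * z).

Definition node_kernel (k c x : R) : R[i] :=
  (k * bump_cos c x 0 +i* (k * bump_cos c x (- (pi / 2))))%C.

Lemma Re_node_atom k c z l t : complex.Re (node_atom k c z l t) =
  (cos (2 * pi * t * - l) * complex.Re z - sin (2 * pi * t * - l) * complex.Im z) *
  (k * bump_at c t).
Proof. by case: z => a b; rewrite /node_atom /=; ring. Qed.

Lemma Im_node_atom k c z l t : complex.Im (node_atom k c z l t) =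
  (cos (2 * pi * t * - l) * complex.Im z + sin (2 * pi * t * - l) * complex.Re z) *
  (k * bump_at c t).
Proof. by case: z => a b; rewrite /node_atom /=; ring. Qed.

Lemma node_atom_bounded (D : set R) k c z l : 0 <= k -> `[c, c + 1]%classic `<=` D ->
  cbounded_on D (k * 30 * norm1 z) (node_atom k c z l).
Proof.
move=> k0 cD; have bb := bump_at_bounded cD.
have bk : bounded_on D (k * 30) (fun t => k * bump_at c t).
  by apply: bounded_onM bb => // t; rewrite ger0_norm.
have mc := @measurable_cos_lin R (- l); have ms := @measurable_sin_lin R (- l).
have cb t : `|cos (2 * pi * t * - l)| <= 1 by exact: cos_max.
have sb t : `|sin (2 * pi * t * - l)| <= 1 by exact: sin_max.
have nM (u v : R) : `|u| <= 1 -> `|u * v| <= `|v| by move=> u1; rewrite normrM ler_piMl.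
rewrite mulrC; split.
- under eq_fun do rewrite Re_node_atom.
  apply: bounded_onM bk.
    by apply: measurable_funB; apply: measurable_funM.
  by move=> t; apply: le_trans (ler_normB _ _) _; rewrite lerD ?nM.
- under eq_fun do rewrite Im_node_atom.
  apply: bounded_onM bk.
    by apply: measurable_funD; apply: measurable_funM.
  by move=> t; apply: le_trans (ler_normD _ _) _; rewrite addrC lerD ?nM.
Qed.

(** Modulating by the frequency [- l] translates the transform by [l]; expanding real and imaginary
    parts leaves only [bump_cos] at the phases 0 and [- (pi / 2)]. *)
Lemma fourier_node_atom k c z l x :
  fourier (node_atom k c z l) x = z * node_kernel k c (x - l).
Proof.
pose D := `[c, c + 1]%classic; pose r := `|c| + 1.
have r0 : 0 <= r by rewrite addr_ge0.
have Dr t : D t -> `|t| <= r.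
  rewrite /D/= in_itv/= /r => /andP[ct tc]; rewrite ler_norml.
  by have := ler_norm c; have := ler_norm (- c); rewrite normrN; lra.
have bb := @bump_at_bounded D c (fun t h => h).
pose I s := (fun t => k * (bump_at c t * cos (2 * pi * (x - l) * t + s))).
have intI s : mu.-integrable setT (EFin \o I s).
  apply: (bounded_on_integrable r0 Dr (B := `|k| * (1 * 30))).
  apply: bounded_onM => //; under eq_fun do rewrite mulrC.
  apply: bounded_onM bb; last by move=> t; exact: cos_max.
  by apply: continuous_measurable_fun; exact: continuous_cos_affine.
have intI' s : mu.-integrable setT (EFin \o (fun t => bump_at c t * cos (2 * pi * (x - l) * t + s))).
  apply: (bounded_on_integrable r0 Dr (B := 1 * 30)).
  under eq_fun do rewrite mulrC.
  apply: bounded_onM bb; last by move=> t; exact: cos_max.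
  by apply: continuous_measurable_fun; exact: continuous_cos_affine.
have intZ (a : R) s : mu.-integrable setT (EFin \o (fun t => a * I s t)).
  rewrite (_ : _ \o _ = (fun t => a%:E * (EFin \o I s) t)%E)//.
  exact: integrableZl.
have IE s : \int[mu]_t I s t = k * bump_cos c (x - l) s.
  by rewrite /I RintegralZl.
have expE t : expi (2 * pi * t * x) * node_atom k c z l t =
    ((complex.Re z * I 0 t - complex.Im z * I (- (pi / 2)) t) +i*
     (complex.Im z * I 0 t + complex.Re z * I (- (pi / 2)) t))%C.
  rewrite /I addr0 cosBpihalf.
  have -> : 2 * pi * (x - l) * t = 2 * pi * t * x + 2 * pi * t * - l by ring.
  rewrite cosD sinD; case: z => a b; rewrite /node_atom /expi.
  by apply/eqP; rewrite eq_complex/=; apply/andP; split; apply/eqP; ring.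
have IZ (a : R) s : \int[mu]_t (a * I s t) = a * (k * bump_cos c (x - l) s).
  by rewrite RintegralZl// IE.
rewrite /fourier (funext expE) /cintegral/= RintegralB// RintegralD// !IZ.
apply/eqP; rewrite eq_complex.
by case: z {expE} => a b /=; apply/andP; split; apply/eqP; ring.
Qed.

End Kernel.

(** * Nonuniqueness from finitely many components with small exponential sums *)

Section Nonuniqueness.
Variables (R : realType) (n : nat) (c : 'I_n -> R) (dl : R).
Hypothesis n_gt0 : (0 < n)%N.
Hypothesis dl_gt0 : 0 < dl.

Let k : R := n%:R^-1.

Let n0 : 0 < n%:R :> R. Proof. by rewrite ltr0n. Qed.

Definition kernel (z : R) : R[i] := \sum_(m < n) node_kernel k (c m) z.

Lemma kernel0 : kernel 0 = 1.
Proof.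
rewrite /kernel (eq_bigr (fun=> k%:C%C)) => [|m _]; last first.
  by rewrite /node_kernel bump_cos_freq0 bump_sin_freq0 mulr1 mulr0.
apply/eqP; rewrite eq_complex Re_sum Im_sum/= !sumr_const cardT size_enum_ord mul0rn eqxx andbT.
by rewrite -mulr_natl /k divff// gt_eqF.
Qed.

(** The coefficients 2, 12, 24 of [Rintegral_bump_cos], each doubled because two trigonometric sums
    occur, with surplus powers of the inverse frequency bounded by powers of [1 / dl]. *)
Definition decay_const : R := 30 * (4 + 24 / dl + 48 / dl ^+ 2).

Lemma decay_const_gt0 : 0 < decay_const.
Proof. by rewrite mulr_gt0// !addr_gt0// divr_gt0// exprn_gt0. Qed.

(** The closed formula for one bump involves its node only through sine and cosine of [w * c m] plus
    a phase, so summing over nodes turns it into exponential sums bounded by [e]. *)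
Lemma sum_bump_cos_decay (z s e : R) : dl <= `|z| ->
  (forall s', `|\sum_(m < n) cos (2 * pi * z * c m + s')| <= e) ->
  `|\sum_(m < n) bump_cos (c m) z s| <= decay_const * e / `|z| ^+ 3.
Proof.
move=> dlz he; set w := 2 * pi * z.
have z0 : 0 < `|z| by exact: lt_le_trans dlz.
have e0 : 0 <= e by apply: le_trans (he 0).
have wz : `|z| <= `|w|.
  rewrite /w normrM ler_peMl// ger0_norm ?mulr_ge0 ?pi_ge0//.
  by have := pi_ge2 R; lra.
have w0 : w != 0 by rewrite -normr_gt0 (lt_le_trans z0).
have hs s' : `|\sum_(m < n) sin (w * c m + s')| <= e.
  have := he (s' - pi / 2); under eq_bigr do rewrite addrA cosBpihalf.
  by [].
pose S1 := \sum_(m < n) sin (w * c m + (w + s)).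
pose S0 := \sum_(m < n) sin (w * c m + s).
pose C1 := \sum_(m < n) cos (w * c m + (w + s)).
pose C0 := \sum_(m < n) cos (w * c m + s).
have -> : \sum_(m < n) bump_cos (c m) z s =
  30 * (- 2 * (S1 - S0) / w ^+ 3 - 12 * (C1 + C0) / w ^+ 4 + 24 * (S1 - S0) / w ^+ 5).
  rewrite (eq_bigr _ (fun m _ => etrans (bump_cosE _ _ _) (Rintegral_bump_cos _ _ w0))).
  rewrite -mulr_sumr; congr (30 * _); rewrite big_split/= sumrB.
  by rewrite -!mulr_suml -!mulr_sumr !sumrB big_split.
have hS : `|S1 - S0| <= 2 * e.
  by apply: le_trans (ler_normB _ _) _; have := hs (w + s); have := hs s; rewrite -/S1 -/S0; lra.
have hC : `|C1 + C0| <= 2 * e.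
  by apply: le_trans (ler_normD _ _) _; have := he (w + s); have := he s; rewrite -/w -/C1 -/C0; lra.
have pw (j : nat) : `|w ^+ j|^-1 <= (`|z| ^+ j)^-1.
  by rewrite normrX lef_pV2 ?posrE ?exprn_gt0// ?lerXn2r ?nnegrE// (lt_le_trans z0).
have pw4 : `|w ^+ 4|^-1 <= dl^-1 * (`|z| ^+ 3)^-1.
  apply: le_trans (pw 4%N) _; rewrite exprS invfM ler_pM2r ?invr_gt0 ?exprn_gt0//.
  by rewrite lef_pV2 ?posrE.
have pw5 : `|w ^+ 5|^-1 <= (dl ^+ 2)^-1 * (`|z| ^+ 3)^-1.
  apply: le_trans (pw 5%N) _; rewrite (exprD _ 2 3) invfM ler_pM2r ?invr_gt0 ?exprn_gt0//.
  by rewrite lef_pV2 ?posrE ?exprn_gt0// lerXn2r ?nnegrE// ltW.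
have pw3 := pw 3%N.
rewrite normrM ger0_norm// /decay_const -!mulrA ler_pM2l//.
apply: le_trans (ler_normD _ _) _.
apply: le_trans (lerD (ler_normB _ _) (lexx _)) _.
have t1 : `|- 2 * (S1 - S0) / w ^+ 3| <= 2 * (2 * e) * (`|z| ^+ 3)^-1.
  by rewrite !normrM normfV ler_pM// normrN normr_nat ler_pM2l.
have t2 : `|12 * (C1 + C0) / w ^+ 4| <= 12 * (2 * e) * (dl^-1 * (`|z| ^+ 3)^-1).
  by rewrite !normrM normfV ler_pM// normr_nat ler_pM2l.
have t3 : `|24 * (S1 - S0) / w ^+ 5| <= 24 * (2 * e) * ((dl ^+ 2)^-1 * (`|z| ^+ 3)^-1).
  by rewrite !normrM normfV ler_pM// normr_nat ler_pM2l.
rewrite (mulrA (- 2)) (mulrA 12) (mulrA 24).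
apply: le_trans (lerD (lerD t1 t2) t3) _.
rewrite le_eqVlt; apply/orP; left; apply/eqP; ring.
Qed.

Lemma kernel_decay (z e : R) : dl <= `|z| ->
  (forall s, `|\sum_(m < n) cos (2 * pi * z * c m + s)| <= e * n%:R) ->
  norm1 (kernel z) <= 2 * decay_const * e / `|z| ^+ 3.
Proof.
move=> dlz he; rewrite /norm1 /kernel Re_sum Im_sum/= -!mulr_sumr.
have k0 : 0 <= k by rewrite invr_ge0.
have h s : `|k * \sum_(m < n) bump_cos (c m) z s| <= decay_const * e / `|z| ^+ 3.
  rewrite normrM (ger0_norm k0) /k.
  rewrite ler_pdivrMl// (_ : n%:R * _ = decay_const * (e * n%:R) / `|z| ^+ 3); last by ring.
  exact: sum_bump_cos_decay.
by have := h 0; have := h (- (pi / 2)); lra.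
Qed.

Variables (W eps : R).
Hypothesis W_large : 16 * decay_const / dl ^+ 2 <= W.
Hypothesis eps_small : 16 * decay_const * eps <= dl ^+ 3.
Hypothesis sum_small : forall z s, dl <= `|z| -> `|z| <= W ->
  `|\sum_(m < n) cos (2 * pi * z * c m + s)| <= eps * n%:R.

(** Up to [W] the exponential sums supply the small factor [eps]; beyond [W] the trivial bound
    suffices, since cubic decay has a factor [1 / |z|] to spare. The constant [dl ^+ 2 / 8] is half
    the inverse of [4 / dl ^+ 2], the bound for separated sums. *)
Lemma kernel_le_inv_sqr z : dl <= `|z| -> norm1 (kernel z) <= dl ^+ 2 / 8 * (z ^+ 2)^-1.
Proof.
move=> dlz; have z0 : 0 < `|z| by exact: lt_le_trans dlz.
have -> : z ^+ 2 = `|z| ^+ 2 by rewrite real_normK ?num_real.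
have pw : `|z| ^- 3 = `|z|^-1 * `|z| ^- 2 by rewrite exprS invfM.
have [zW|/ltW zW] := leP `|z| W.
- apply: le_trans (kernel_decay dlz (fun s => sum_small s dlz zW)) _.
  rewrite pw mulrA ler_pM2r ?invr_gt0 ?exprn_gt0// ler_pdivrMr//.
  apply: (@le_trans _ _ (dl ^+ 2 / 8 * dl)); last by rewrite ler_pM2l// divr_gt0 ?exprn_gt0.
  by move: eps_small; rewrite (exprSr dl 2); lra.
- have h s : `|\sum_(m < n) cos (2 * pi * z * c m + s)| <= 1 * n%:R.
    rewrite mul1r; apply: le_trans (sum_cos_le _ _) _.
    by rewrite -[index_enum _]enumT size_enum_ord.
  apply: le_trans (kernel_decay dlz h) _.
  rewrite mulr1 pw mulrA ler_pM2r ?invr_gt0 ?exprn_gt0// ler_pdivrMr//.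
  have dl2 : 0 < dl ^+ 2 by rewrite exprn_gt0.
  have : 16 * decay_const <= W * dl ^+ 2 by rewrite -ler_pdivrMr.
  have : W * dl ^+ 2 <= `|z| * dl ^+ 2 by rewrite ler_pM2r.
  by lra.
Qed.

Lemma kernel_small (A : seq R) : uniq A ->
  {in A &, forall a b, a != b -> dl <= `|a - b|} -> {in A, forall a, dl <= `|a|} ->
  \sum_(a <- A) norm1 (kernel a) <= 1 / 2.
Proof.
move=> uA sepA geA.
apply: (@le_trans _ _ (\sum_(a <- A) dl ^+ 2 / 8 * (a ^+ 2)^-1)).
  by rewrite big_seq [leRHS]big_seq ler_sum// => a /geA; exact: kernel_le_inv_sqr.
have dl2 : 0 < dl ^+ 2 by rewrite exprn_gt0.
rewrite -mulr_sumr (_ : 1 / 2 = dl ^+ 2 / 8 * (4 / dl ^+ 2)); last by field; rewrite gt_eqF.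
by rewrite ler_pM2l ?divr_gt0// sum_inv_sqr_separated.
Qed.

Lemma nodes_nonuniqueness (S : set R) (alpha : R) (L : set R) : 0 <= alpha ->
  (forall m, `[c m, c m + 1]%classic `<=` S) ->
  (forall l l', L l -> L l' -> l != l' -> 2 * dl <= `|l - l'|) ->
  ~ uniqueness_set L (W_space alpha S).
Proof.
move=> alpha0 cS L_sep uniqL.
(* Separation [2 * dl] leaves room for a new point: shift some point of [L] by [dl], or take 0 if
   [L] is empty. *)
have [l0 l0L] : exists l0, forall l, L l -> dl <= `|l - l0|.
  have [[l Ll]|Lempty] := pselect (exists l, L l); last first.
    by exists 0 => l Ll; exfalso; apply: Lempty; exists l.
  exists (l + dl) => l' Ll'; have [->|l'l] := eqVneq l' l.
    by rewrite opprD addrA subrr add0r normrN ger0_norm// ltW.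
  have := L_sep _ _ Ll' Ll l'l; have := ler_normD (l' - (l + dl)) dl.
  rewrite (gtr0_norm dl_gt0) (_ : l' - (l + dl) + dl = l' - l); [lra|ring].
pose L' := L `|` [set l0].
have L'_sep a b : L' a -> L' b -> a != b -> dl <= `|a - b|.
  move=> [La|->] [Lb|->] ab.
  - by have := L_sep _ _ La Lb ab; have := dl_gt0; lra.
  - exact: l0L.
  - by rewrite distrC; exact: l0L.
  - by rewrite eqxx in ab.
pose D := \bigcup_m `[c m, c m + 1]%classic.
pose r := \sum_(m < n) `|c m| + 1.
have r0 : 0 <= r by rewrite addr_ge0// sumr_ge0.
have Dr t : D t -> `|t| <= r.
  move=> [m _]; rewrite /= in_itv/= => /andP[h1 h2].
  have cm : `|c m| <= \sum_(m < n) `|c m|.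
    by rewrite (bigD1 m)//= lerDl sumr_ge0.
  have := ler_norm (c m); have := ler_norm (- c m); rewrite normrN => a1 a2.
  by rewrite /r ler_norml; apply/andP; split; lra.
pose atom z l t := \sum_(m < n) node_atom k (c m) z l t.
have k0 : 0 <= k by rewrite invr_ge0.
have bnode z l m : cbounded_on D (k * 30 * norm1 z) (node_atom k (c m) z l).
  by apply: node_atom_bounded => // t ht; exists m.
have bfatom z l := fourier_sum r0 Dr (index_enum 'I_n) (bnode z l).
pose C : R := n%:R * (k * 30).
have C0 : 0 <= C by rewrite !mulr_ge0.
have batom z l : cbounded_on D (C * norm1 z) (atom z l).
  have [+ _] := bfatom z l; rewrite sumr_const cardT size_enum_ord.
  by rewrite -[X in cbounded_on D X](mulr_natl _ n) mulrA.
have fatom z l x : fourier (atom z l) x = z * kernel (x - l).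
  have [_ ->] := bfatom z l; rewrite /kernel mulr_sumr.
  by apply: eq_bigr => m _; exact: fourier_node_atom.
pose y (x : R) : R[i] := if x == l0 then 1 else 0.
have y1 : l1_le L' y 1.
  move=> A uA _; have [l0A|l0A] := boolP (l0 \in A).
    rewrite (bigD1_seq l0)//= big1 => [|a /negbTE al0]; last by rewrite /y al0 norm10.
    by rewrite /y eqxx /norm1/= normr1 normr0 !addr0.
  rewrite big_seq big1// => a aA; rewrite /y ifN ?norm10//.
  by apply: contraNneq l0A => <-.
have [B [F [bF FE]]] := greedy_interpolation r0 Dr C0 batom fatom kernel0 kernel_small L'_sep y1.
have F0 : fourier F = fun=> 0.
  apply: uniqL.
    by apply: (fourier_W_space r0 Dr _ _ bF) => // t [m _]; exact: cS.
  move=> l Ll; rewrite FE; last by left.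
  rewrite /y ifN//; apply/eqP => ll0; have := l0L _ Ll.
  by rewrite ll0 subrr normr0 leNgt dl_gt0.
have := FE l0 (or_intror erefl); rewrite F0 /y eqxx => /eqP.
by rewrite eq_sym oner_eq0.
Qed.

End Nonuniqueness.

(** * Almost sure nonuniqueness for all separations at once *)

Theorem theorem8 (R : realType) (d : measure_display) (T : measurableType d)
    (P : probability T R) (xi : nat -> {RV P >-> R}) (gamma1 alpha : R) :
  mutually_independent xi ->
  (forall j, uniform23 (xi j)) ->
  1 / 2 < alpha ->
  {ae P, forall w : T, forall L : set R, uniformly_discrete L ->
      ~ uniqueness_set L (W_space alpha (S_set gamma1 (fun j => xi j w)))}.
Proof.
move=> xi_indep xi_unif alpha12.
have alpha0 : 0 <= alpha by lra.
(* The exceptional null set must not depend on [L], so only countably many separations are treated,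
   and their null sets are united. *)
pose dl (n : nat) : R := n.+1%:R^-1.
have dl0 n : 0 < dl n by rewrite invr_gt0.
have dl1 n : dl n <= 1 by rewrite invf_le1 ?ler1n.
suff good n : {ae P, forall w, forall L : set R,
    (forall l l', L l -> L l' -> l != l' -> 2 * dl n <= `|l - l'|) ->
    ~ uniqueness_set L (W_space alpha (S_set gamma1 (fun j => xi j w)))}.
  apply: filterS (ae_foralln good) => w goodw L [e e0 Le].
  (* This index makes [2 * dl n] at most the separation [e] of [L]. *)
  apply: (goodw (Num.truncn (2 / e))) => l l' Ll Ll' ll'.
  apply: le_trans (Le _ _ Ll Ll' ll').
  rewrite /dl ler_pdivrMr ?ltr0n// mulrC -ler_pdivrMr//.
  exact/ltW/truncnS_gt.
have dc0 := decay_const_gt0 (dl0 n).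
(* [W] and [eps] meet the two smallness conditions on the kernel; the added 1 ensures [1 <= W],
   which the run construction asks for. *)
pose W := 1 + 16 * decay_const (dl n) / dl n ^+ 2.
pose eps := dl n ^+ 3 / (16 * decay_const (dl n)).
have eps0 : 0 < eps by apply: divr_gt0; [exact: exprn_gt0|exact: mulr_gt0].
have h0 : 0 <= 16 * decay_const (dl n) / dl n ^+ 2.
  by apply: divr_ge0; [rewrite mulr_ge0// ltW|rewrite exprn_ge0// ltW].
have W1 : 1 <= W by rewrite lerDl.
have [N [q [tau [N0 tau0 hq hsum]]]] := run_exponential_sum (dl0 n) (dl1 n) W1 eps0.
apply: filterS (near_pattern_ae xi_indep xi_unif N tau0 hq) => w [a ha] L Lsep.
pose x j := xi j w; pose c (m : 'I_N) := gamma_seq gamma1 x (a + m).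
apply: (@nodes_nonuniqueness R N c (dl n) N0 (dl0 n) W eps) => //.
- by rewrite lerDr.
- by rewrite /eps mulrC divfK// gt_eqF// mulr_gt0.
- move=> z s h1 h2; have := hsum gamma1 x a ha z s h1 h2.
  by rewrite big_mkord.
- by move=> m t ht; exists (a + m)%N.
Qed.
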